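(* Let $\mathcal{A}$ be a class of modular lattices such that $\mathrm{L}(V)\in\mathcal{A}$ for some vector space $V$ of infinite dimension. Then the Finiteness Problem for $\mathcal{A}$ is algorithmically unsolvable.
   Context: For a vector space $V$, $\mathrm{L}(V)$ denotes the lattice of subspaces of $V$. A finite presentation is a finite list of generator symbols together with a finite list of relations, each relation being an equation $s=t$ between lattice terms (built from binary meet and join) in the generator symbols. A lattice admits the presentation if it has a system of generators (an assignment of elements to the generator symbols that together generate the lattice) satisfying the given relations. Given a class $\mathcal{A}$ of lattices, the Finiteness Problem for $\mathcal{A}$ is to decide, for any given finite presentation, whether or not there is a finite bound on the size of the members of $\mathcal{A}$ which admit the presentation.
   Formalization: The class is also assumed to contain every finitely generated lattice that embeds in one of its members; without this the claim fails, e.g. for the class {L(V)}, as L(V) is uncountable and so admits no finite presentation. *)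

(* Defs.v *)
From HB Require Import structures.
From mathcomp Require Import all_boot all_order all_algebra.
From mathcomp Require Import boolp classical_sets functions cardinality.
From mathcomp Require Import zify.

Set Implicit Arguments.
Unset Strict Implicit.
Unset Printing Implicit Defensive.

Import Order.TTheory GRing.Theory.
Local Open Scope classical_set_scope.
Local Open Scope ring_scope.

Record subspace (F : fieldType) (V : lmodType F) := Subspace {
  subspace_set : set V;
  _ : `[< GRing.submod_closed [in subspace_set] >]
}.

HB.instance Definition _ (F : fieldType) (V : lmodType F) :=
  [isSub for @subspace_set F V].
HB.instance Definition _ (F : fieldType) (V : lmodType F) :=
  [Choice of subspace V by <:].
(* The order is inherited from [set V], i.e. it is inclusion. *)
HB.instance Definition _ (F : fieldType) (V : lmodType F) :=
  [SubChoice_isSubPOrder of subspace V by <: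
     with Order.Disp tt tt].

Section SubspaceLattice.
Context (F : fieldType) (V : lmodType F).
Implicit Types U W X : subspace V.

Lemma subspaceP U : subspace_set U 0 /\
  (forall (a : F) u v,
     subspace_set U u -> subspace_set U v -> subspace_set U (a *: u + v)).
Proof.
case: U => U /= /asboolP[U0 UL]; split; first by move: U0; rewrite !inE.
by move=> a u v Uu Uv; have := UL a u v; rewrite !inE; apply.
Qed.

Lemma subspace_leP U W :
  reflect (subspace_set U `<=` subspace_set W) (U <= W)%O.
Proof. by rewrite leEsub /= -subsetEset; exact: idP. Qed.

Lemma submod_closedI U W :
  `[< GRing.submod_closed [in subspace_set U `&` subspace_set W] >].
Proof.
have [U0 UL] := subspaceP U; have [W0 WL] := subspaceP W.
apply/asboolP; split; first by rewrite !inE.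
move=> a u v; rewrite !inE => -[Uu Wu] [Uv Wv].
by split; [exact: UL|exact: WL].
Qed.

Lemma submod_closedD U W :
  `[< GRing.submod_closed
        [in [set u + w | u in subspace_set U & w in subspace_set W]] >].
Proof.
have [U0 UL] := subspaceP U; have [W0 WL] := subspaceP W.
apply/asboolP; split.
  by rewrite !inE; exists 0 => //; exists 0 => //; rewrite addr0.
move=> a x y; rewrite !inE => -[u Uu [w Ww <-]] [u' Uu' [w' Ww' <-]].
exists (a *: u + u'); first exact: UL.
exists (a *: w + w'); first exact: WL.
by rewrite scalerDr addrACA.
Qed.

Definition subspace_meet U W : subspace V := Subspace (submod_closedI U W).
Definition subspace_join U W : subspace V := Subspace (submod_closedD U W).

Lemma subspace_meetP U W X :
  (U <= subspace_meet W X)%O = (U <= W)%O && (U <= X)%O.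
Proof.
apply/subspace_leP/andP => [le|[/subspace_leP UW /subspace_leP UX] v Uv].
  by split; apply/subspace_leP => v /le[].
by split; [exact: UW|exact: UX].
Qed.

Lemma subspace_joinP U W X :
  (subspace_join U W <= X)%O = (U <= X)%O && (W <= X)%O.
Proof.
have [U0 _] := subspaceP U; have [W0 _] := subspaceP W.
have [_ XL] := subspaceP X.
apply/subspace_leP/andP => [le|[/subspace_leP UX /subspace_leP WX] v].
  split; apply/subspace_leP => v vin; apply: le.
    by exists v => //; exists 0 => //; rewrite addr0.
  by exists 0 => //; exists v => //; rewrite add0r.
move=> [u Uu [w Ww <-]]; rewrite -[u]scale1r.
by apply: XL; [exact: UX|exact: WX].
Qed.

End SubspaceLattice.

HB.instance Definition _ (F : fieldType) (V : lmodType F) :=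
  Order.POrder_MeetJoin_isLattice.Build (Order.Disp tt tt) (subspace V)
    (@subspace_meetP F V) (@subspace_joinP F V).

Definition infinite_dimensional (F : fieldType) (V : lmodType F) : Prop :=
  ~ exists (n : nat) (b : 'I_n -> V),
      forall v : V, exists c : 'I_n -> F, v = \sum_(i < n) c i *: b i.

Definition modular (d : Order.disp_t) (L : latticeType d) : Prop :=
  forall x y z : L,
    (x <= z)%O -> (x `|` (y `&` z) = (x `|` y) `&` z)%O.

Definition lattice_class := forall d : Order.disp_t, latticeType d -> Prop.

Definition generates (d : Order.disp_t) (L : latticeType d) (n : nat)
    (g : 'I_n -> L) : Prop :=
  forall S : set L,
    (forall i, S (g i)) ->
    (forall x y, S x -> S y -> S (x `&` y)%O /\ S (x `|` y)%O) ->
    forall x, S x.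

Definition finitely_generated (d : Order.disp_t) (L : latticeType d) : Prop :=
  exists (n : nat) (g : 'I_n -> L), generates g.

(* Sublattices are taken up to isomorphism, i.e. as embedded lattices.
   Some closure of the class is needed: a finitely generated lattice is
   countable, so L(V) for V of infinite dimension admits no finite presentation
   itself, and the one-element class {L(V)} would give a trivial problem. *)
Definition closed_under_fg_sublattices (A : lattice_class) : Prop :=
  forall (d : Order.disp_t) (L : latticeType d)
         (d' : Order.disp_t) (M : latticeType d') (f : {lmorphism M -> L}),
    A d L -> injective f -> finitely_generated M -> A d' M.

Inductive lterm (n : nat) : Type :=
| LGen of 'I_n
| LMeet of lterm n & lterm n
| LJoin of lterm n & lterm n.
Arguments LGen {n}.

Fixpoint lterm_eval (d : Order.disp_t) (L : latticeType d) (n : nat)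
    (g : 'I_n -> L) (t : lterm n) : L :=
  match t with
  | LGen i => g i
  | LMeet s t => (lterm_eval g s `&` lterm_eval g t)%O
  | LJoin s t => (lterm_eval g s `|` lterm_eval g t)%O
  end.

Record presentation := Presentation {
  pres_ngens : nat;
  pres_rels : seq (lterm pres_ngens * lterm pres_ngens)
}.

Definition satisfies (d : Order.disp_t) (L : latticeType d) (n : nat)
    (g : 'I_n -> L) (rels : seq (lterm n * lterm n)) : Prop :=
  foldr (fun r Q => lterm_eval g r.1 = lterm_eval g r.2 /\ Q) True rels.

Definition admits (d : Order.disp_t) (L : latticeType d) (P : presentation)
    : Prop :=
  exists g : 'I_(pres_ngens P) -> L, generates g /\ satisfies g (pres_rels P).

Definition finitely_bounded (A : lattice_class) (P : presentation) : Prop :=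
  exists N : nat, forall (d : Order.disp_t) (L : latticeType d),
    A d L -> admits L P -> ([set: L] #<= `I_N)%card.

(* Kleene's partial recursive functions, of explicit arity. *)
Inductive recfun : nat -> Type :=
| RZero n : recfun n
| RSucc : recfun 1
| RProj n : 'I_n -> recfun n
| RComp m n : recfun m -> ('I_m -> recfun n) -> recfun n
| RPrec n : recfun n -> recfun n.+2 -> recfun n.+1
| RMu n : recfun n.+1 -> recfun n.

(* Graph of the function h with h(0, xs) = f(xs) and
   h(k+1, xs) = g(k, h(k, xs), xs). *)
Fixpoint prec_graph (n : nat) (f : n.-tuple nat -> nat -> Prop)
    (g : n.+2.-tuple nat -> nat -> Prop) (xs : n.-tuple nat) (k z : nat)
    : Prop :=
  match k with
  | 0 => f xs z
  | k'.+1 => exists y, prec_graph f g xs k' y /\ g [tuple of k' :: y :: xs] z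
  end.

(* [rec_graph f xs z]: f is defined at xs, with value z. *)
Fixpoint rec_graph (n : nat) (f : recfun n) : n.-tuple nat -> nat -> Prop :=
  match f in recfun n return n.-tuple nat -> nat -> Prop with
  | RZero n => fun _ z => z = 0%N
  | RSucc => fun xs z => z = (thead xs).+1
  | RProj n i => fun xs z => z = tnth xs i
  | RComp m n f g => fun xs z =>
      exists ys : m.-tuple nat,
        (forall i, rec_graph (g i) xs (tnth ys i)) /\ rec_graph f ys z
  | RPrec n f g => fun xs z =>
      prec_graph (rec_graph f) (rec_graph g) [tuple of behead xs] (thead xs) z
  | RMu n f => fun xs z =>
      rec_graph f [tuple of z :: xs] 0%N /\
      forall y, (y < z)%N ->
        exists w : nat, rec_graph f [tuple of y :: xs] w.+1
  end.

(* Cantor's pairing function. *)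
Definition cpair (a b : nat) : nat := ('C((a + b).+1, 2) + b)%N.

Fixpoint lterm_code (n : nat) (t : lterm n) : nat :=
  match t with
  | LGen i => cpair 0 i
  | LMeet s t => cpair 1 (cpair (lterm_code s) (lterm_code t))
  | LJoin s t => cpair 2 (cpair (lterm_code s) (lterm_code t))
  end.

Definition rels_code (n : nat) (rels : seq (lterm n * lterm n)) : nat :=
  foldr (fun r c => (cpair (cpair (lterm_code r.1) (lterm_code r.2)) c).+1)
    0%N rels.

Definition pres_code (P : presentation) : nat :=
  cpair (pres_ngens P) (rels_code (pres_rels P)).

Lemma cpair_inj a b a' b' : cpair a b = cpair a' b' -> a = a' /\ b = b'.
Proof.
have mono m n : (m < n)%N -> ('C(m.+1, 2) + m < 'C(n.+1, 2))%N.
  move=> lt_mn; have := leq_bin2l 2 (lt_mn : (m.+2 <= n.+1)%N).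
  by rewrite [X in (X <= _)%N]binS bin1; lia.
rewrite /cpair => e.
have ab : (a + b)%N = (a' + b')%N.
  by case: (ltngtP (a + b)%N (a' + b')%N) => // /mono; lia.
by move: e; rewrite ab; lia.
Qed.

Lemma lterm_code_inj n : injective (@lterm_code n).
Proof.
elim=> [i|s IHs t IHt|s IHs t IHt] [j|s' t'|s' t'] //= /cpair_inj[] // _.
- by move/val_inj->.
- by case/cpair_inj => /IHs-> /IHt->.
- by case/cpair_inj => /IHs-> /IHt->.
Qed.

Lemma pres_code_inj : injective pres_code.
Proof.
move=> [n r] [n' r'] /cpair_inj[/= en]; case: _ / en r' => r' er.
congr Presentation; elim: r r' er => [|[s t] r IH] [|[s' t'] r'] //= [].
by case/cpair_inj => /cpair_inj[/lterm_code_inj-> /lterm_code_inj->] /IH->.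
Qed.

Definition algorithmically_solvable (Q : presentation -> Prop) : Prop :=
  exists f : recfun 1, forall P : presentation,
    (Q P -> rec_graph f [tuple pres_code P] 1%N) /\
    (~ Q P -> rec_graph f [tuple pres_code P] 0%N).

(* Main.v *)
From HB Require Import structures.
Require Import Defs.
From mathcomp Require Import all_boot all_order all_algebra.
From mathcomp Require Import boolp classical_sets functions cardinality.
From mathcomp Require Import zify.

Set Implicit Arguments.
Unset Strict Implicit.
Unset Printing Implicit Defensive.
Import Order.TTheory GRing.Theory.

(** The Finiteness Problem is undecidable because a finite presentation can
    run a computation inside the subspace lattice of an infinite dimensional
    space: if the computation halts, the relations force every modular lattice
    admitting the presentation to have one element, and if it does not halt,
    they hold for suitable generators of an infinite sublattice of [L(V)].

    Coding.  Let [A], [B], [C] be independent elements of a lattice.  An element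
    [f <= A \/ B] acts as a linear relation from [A] to [B]: it sends [y <= A]
    to [(y \/ f) /\ B].  The modular law makes this action compatible with
    composition of relations ([rel_image_comp]).  Hence a single equation between
    two composites of generators gives the corresponding identity for the action
    on all [y <= A]; in this way one relation makes two letters commute
    ([act_comm]).  A letter is a generator [f <= A \/ B], brought back to [A]
    through fixed generators [d <= B \/ C] and [e <= C \/ A].  A configuration of
    a machine with finitely many stacks is the element obtained from a generator
    [x_q <= A], [q] being the control state, by letting the letters of each stack
    act, the top of the stack first.  Letters of different stacks commute, so each
    stack can be moved next to [x_q], and an instruction becomes one or two
    inequalities between elements such as [x_q], [f x_q] and [g x_q'].  The action
    is monotone, so a step of the machine can only increase the element
    ([conf_elt_step]).  A halting state has [x_q <= 0], so a halting computation
    gives [c0 <= 0] for its start configuration [c0]; a last generator [r], with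
    [B <= c0 \/ r] and [(0 \/ r) /\ B <= 0], then brings down [B], and with it
    the whole lattice ([halting_collapse]).

    Model.  If the machine does not halt, take the vector space whose basis is
    the set of pairs of a configuration and a natural number, realized as the
    space [P] of polynomials.  Two configurations are identified when they have
    a common descendant, and those leading to a halting state are sent to [0].
    Adding a letter at the bottom of a stack respects both operations, because
    the machine only looks at the tops, and therefore defines linear maps; in
    [L(P * P * P)] their graphs satisfy all the relations ([ineqs_hold]).  The
    second component of the basis gives each configuration infinite dimension,
    so that [c0], not being [0], can be mapped onto all of [P], as [r] demands
    ([start_holds]).  One generator, subject to no relation beyond being between
    the bounds, is interpreted as multiplication by ['X] and makes the sublattice
    infinite ([iter_shift_inj]).  A linear embedding of [P * P * P] in [V]
    transports the model to [L(V)].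

    Diagonalization.  Suppose that [f] decides the problem.  The presentation
    attached to a machine and to two inputs [n], [m] depends on the inputs only
    through one relation, the start relation, whose generators have numbers that
    do not depend on the machine.  Hence the code of a presentation with [n]
    generators, whose relations are the start relation for [n], [m] and the
    relations with code [m], is a computable function of [n] and [m].  Compile
    [f] after this function to a machine that halts on the answer [0] and loops
    on the answer [1] ([recfun_machine]), and give it as inputs its own number of
    generators and the code of its own relations: the presentation is bounded if
    [f] says that it is not, and unbounded if [f] says that it is bounded. *)

(** * Deterministic iteration and counter programs *)

Section Reach.
Variables (T : Type) (f : T -> option T).

Definition reach (x y : T) : Prop :=
  exists n, iter n (obind f) (Some x) = Some y.

Lemma reach_refl x : reach x x.
Proof. by exists 0. Qed.

Lemma reach_trans x y z : reach x y -> reach y z -> reach x z.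
Proof. by move=> [n xy] [m yz]; exists (m + n); rewrite iterD xy. Qed.

Lemma reach_step x y : f x = Some y -> reach x y.
Proof. by exists 1. Qed.

Lemma reach_elim (P : T -> Prop) y : P y ->
  (forall x x', f x = Some x' -> P x' -> P x) -> forall x, reach x y -> P x.
Proof.
move=> Py Pstep x [n]; elim: n x => [|n IH] x; first by case=> ->.
rewrite iterSr /=; case fx : (f x) => [x'|]; first by move/IH; exact: Pstep.
suff -> : iter n (obind f) None = None by [].
by elim: n {IH} => //= n ->.
Qed.

Lemma reach_linear x y z : reach x y -> reach x z -> reach y z \/ reach z y.
Proof.
move=> [n xy] [m xz]; case: (leqP n m) => [le|/ltnW le]; [left|right].
  by exists (m - n); rewrite -xy -iterD subnK.
by exists (n - m); rewrite -xz -iterD subnK.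
Qed.

Lemma reach_stuck x y : f x = None -> reach x y -> y = x.
Proof.
move=> fx xy; move: fx;
  apply: (@reach_elim (fun z => f z = None -> y = z) y _ _ x xy) => // z z' -> //.
Qed.

(** Going around the cycle often enough overtakes any number of steps, so a
    stuck state cannot be reached at any time. *)
Lemma cycle_not_stuck x x' y : f x = Some x' -> reach x' x -> reach x y ->
  f y <> None.
Proof.
move=> xx' [n x'x] [m xy] fy.
have cyc k : iter (k * n.+1) (obind f) (Some x) = Some x.
  elim: k => // k IH.
  by rewrite mulSn addnC iterD iterSr /= xx' x'x IH.
have : iter (m * n.+1 - m) (obind f) (Some y) = Some x.
  by rewrite -xy -iterD subnK ?cyc //; lia.
move=> yx; have yx' : reach y x by exists (m * n.+1 - m).
by move: (fy); rewrite -(reach_stuck fy yx') xx'.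
Qed.
End Reach.

(** Every constructor carries the rest of the program.  A program is thus its
    own continuation, and control states are programs.  The command [Loop r b]
    is: while register [r] is positive, decrement it and run [b]. *)
Inductive prog := Done | Inc of nat & prog | Loop of nat & prog & prog.

Fixpoint seqp p k := match p with
  | Done => k
  | Inc r p => Inc r (seqp p k)
  | Loop r b p => Loop r b (seqp p k)
  end.
Notation "p ;; k" := (seqp p k) (at level 60, right associativity).

Lemma seqpA p q k : (p ;; q) ;; k = p ;; q ;; k.
Proof. by elim: p => //= [r p ->|r b _ p ->]. Qed.

Lemma seqp_done p : p ;; Done = p.
Proof. by elim: p => //= [r p ->|r b _ p ->]. Qed.

Definition upd (st : nat -> nat) r v := fun i => if i == r then v else st i.

Definition pstep (c : prog * (nat -> nat)) : option (prog * (nat -> nat)) :=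
  let: (p, st) := c in
  match p with
  | Done => None
  | Inc r k => Some (k, upd st r (st r).+1)
  | Loop r b k =>
      if st r is n.+1 then Some (b ;; p, upd st r n) else Some (k, st)
  end.

(** Quantifying over what remains to be run makes executions composable. *)
Definition exec p st st' := forall k, reach pstep (p ;; k, st) (k, st').

Ltac store_ext := apply: funext => ?; rewrite /upd /=;
  repeat case: eqP => ?; try subst; try congruence; try lia.

Lemma exec_done st : exec Done st st.
Proof. by move=> k; exact: reach_refl. Qed.

Lemma exec_seq p q st st1 st2 :
  exec p st st1 -> exec q st1 st2 -> exec (p ;; q) st st2.
Proof. by move=> e1 e2 k; rewrite seqpA; apply: reach_trans (e1 _) (e2 _). Qed.

Definition inc_reg r := Inc r Done.
Definition loop r b := Loop r b Done.
Definition clear_reg r := loop r Done.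
Definition move_reg x y := loop x (inc_reg y).
(** The value must be kept in [x]: it is doubled into [y] and [t], and the copy
    in [t] is moved back. *)
Definition copy_reg x y t := loop x (inc_reg y ;; inc_reg t) ;; move_reg t x.

Lemma exec_inc_reg r st : exec (inc_reg r) st (upd st r (st r).+1).
Proof. by move=> k; exact: reach_step. Qed.

Lemma exec_loop0 r b st : st r = 0 -> exec (loop r b) st st.
Proof. by move=> st0 k; apply: reach_step; rewrite /= st0. Qed.

Lemma exec_loopS r b st n st1 st2 : st r = n.+1 -> exec b (upd st r n) st1 ->
  exec (loop r b) st1 st2 -> exec (loop r b) st st2.
Proof.
move=> stS e1 e2 k; apply: reach_trans (reach_step _) _.
  by rewrite /= stS.
by apply: reach_trans (e1 _) _; exact: e2.
Qed.

Lemma exec_clear_reg r st : exec (clear_reg r) st (upd st r 0).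
Proof.
have [n] := ubnP (st r); elim: n st => // n IH st; rewrite ltnS.
case str : (st r) => [|m] le.
  have -> : upd st r 0 = st by store_ext.
  exact: exec_loop0.
apply: (exec_loopS str (exec_done _)).
have -> : upd st r 0 = upd (upd st r m) r 0 by store_ext.
by apply: IH; rewrite /upd eqxx.
Qed.

Lemma exec_move_reg x y st : x != y ->
  exec (move_reg x y) st (upd (upd st y (st y + st x)) x 0).
Proof.
move=> /eqP xy; have [n] := ubnP (st x); elim: n st => // n IH st; rewrite ltnS.
case stx : (st x) => [|m] le.
  have -> : upd (upd st y (st y + 0)) x 0 = st
    by store_ext.
  exact: exec_loop0.
apply: (exec_loopS stx (exec_inc_reg _ _)).
set st1 := upd _ _ _.
have -> : upd (upd st y (st y + m.+1)) x 0 = upd (upd st1 y (st1 y + st1 x)) x 0.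
  by rewrite /st1; store_ext.
by apply: IH; rewrite /st1 /upd; case: eqP => //; rewrite eqxx.
Qed.

Lemma exec_copy_reg x y t st : x != y -> x != t -> y != t -> st y = 0 -> st t = 0 ->
  exec (copy_reg x y t) st (upd st y (st x)).
Proof.
move=> /eqP xy xt /eqP yt sty stt.
pose st1 a b := upd (upd (upd st x a) y b) t b.
have loop1 a b : exec (loop x (inc_reg y ;; inc_reg t)) (st1 a b) (st1 0 (b + a)).
  elim: a b => [|a IH] b.
    by rewrite addn0; apply: exec_loop0; rewrite /st1 /upd;
      move/eqP: xy => /negPf ->; rewrite (negPf xt) eqxx.
  apply: (@exec_loopS _ _ _ a (st1 a b.+1)); last by rewrite -addSnnS; exact: IH.
    by rewrite /st1 /upd; move/eqP: xy => /negPf ->; rewrite (negPf xt) eqxx.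
  suff -> : st1 a b.+1 = upd (upd (upd (st1 a.+1 b) x a) y b.+1) t b.+1.
    apply: exec_seq (exec_inc_reg _ _) _.
    have -> : (upd (st1 a.+1 b) x a y) = b.
      by rewrite /st1 /upd eqxx; do !case: eqP => //; congruence.
    set s := upd _ _ _; have -> : b = s t.
      rewrite /s /st1 /upd eqxx; move/eqP: yt; rewrite eq_sym => /negPf->.
      by rewrite eq_sym (negPf xt).
    exact: exec_inc_reg.
  by rewrite /st1; move/eqP: xt => xt; store_ext.
apply: exec_seq (_ : exec _ _ (st1 0 (st x))) _.
  have {1}-> : st = st1 (st x) 0.
    by rewrite /st1; store_ext.
  exact: loop1.
have -> : upd st y (st x) = upd (upd (st1 0 (st x)) x
    (st1 0 (st x) x + st1 0 (st x) t)) t 0.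
  by rewrite /st1; move/eqP: xt => xt; store_ext.
by apply: exec_move_reg; rewrite eq_sym.
Qed.

(** * Compiling recursive functions to counter programs *)

Arguments seqp : simpl never.

Fixpoint seqps (ps : seq prog) : prog :=
  if ps is p :: ps' then p ;; seqps ps' else Done.

(** The inputs are read in the registers [ins] and the value is written in
    register [o].  Registers from [b] on are scratch registers: all of them
    contain [0] when the program starts, and again when it ends. *)
Fixpoint compile n (f : recfun n) (ins : seq nat) (o b : nat) : prog :=
  match f with
  | RZero _ => Done
  | RSucc => copy_reg (nth 0 ins 0) o b ;; inc_reg o
  | RProj _ i => copy_reg (nth 0 ins i) o b
  | RComp m _ f g =>
      seqps [seq compile (g i) ins (b + i) (b + m) | i <- enum 'I_m] ;;
      compile f (iota b m) o (b + m) ;;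
      seqps [seq clear_reg r | r <- iota b m]
  | RPrec _ f g =>
      let xs := behead ins in
      copy_reg (nth 0 ins 0) b b.+3 ;;
      compile f xs o b.+3 ;;
      loop b (compile g [:: b.+1, o & xs] b.+2 b.+3 ;;
              clear_reg o ;; move_reg b.+2 o ;; inc_reg b.+1) ;;
      clear_reg b.+1
  | RMu _ f =>
      compile f (b :: ins) b.+1 b.+2 ;;
      loop b.+1 (clear_reg b.+1 ;; inc_reg b ;; compile f (b :: ins) b.+1 b.+2) ;;
      move_reg b o
  end.

(** The whole sequence of intermediate values is what a loop invariant can
    refer to. *)
Lemma prec_graph_seq n (f : n.-tuple nat -> nat -> Prop) g xs k z :
  prec_graph f g xs k z -> exists y : nat -> nat,
    [/\ y k = z, f xs (y 0) &
        forall i, i < k -> g [tuple of i :: y i :: xs] (y i.+1)].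
Proof.
elim: k z => [|k IH] z /=; first by move=> fz; exists (fun=> z).
move=> [w [/IH [y [yk fy gy]] gz]].
pose y' i := if i == k.+1 then z else y i.
have y'E i : i <= k -> y' i = y i by move=> ik; rewrite /y' ltn_eqF.
exists y'; split; [by rewrite /y' eqxx|by rewrite y'E|move=> i].
rewrite ltnS => ik; rewrite y'E //; move: ik; rewrite leq_eqVlt.
case/orP => [/eqP ->|ltik]; last by rewrite y'E //; exact: gy.
by rewrite yk /y' eqxx.
Qed.

Lemma map_upd st r v (s : seq nat) : r \notin s ->
  map (upd st r v) s = map st s.
Proof.
move=> rs; apply/eq_in_map => x xs; rewrite /upd ifN //.
by apply: contraNneq rs => <-.
Qed.

Section CompileExec.

(** The final store is given exactly: the only net effect is one write.
    Compiled subprograms can then be run one after the other, each finding its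
    scratch registers empty. *)
Definition compile_ok n (f : recfun n) := forall ins o b st (xs : n.-tuple nat) v,
  tval xs = map st ins -> (forall r, r \in ins -> r < b) -> o < b ->
  o \notin ins -> st o = 0 -> (forall r, b <= r -> st r = 0) ->
  rec_graph f xs v -> exec (compile f ins o b) st (upd st o v).

Lemma notin_ge (ins : seq nat) b r :
  (forall r, r \in ins -> r < b) -> b <= r -> r \notin ins.
Proof. by move=> H; apply: contraTN => /H; rewrite ltnNge. Qed.

Lemma compile_zero n : compile_ok (RZero n).
Proof.
move=> ins o b st xs v _ _ _ _ sto _ /= ->.
have -> : upd st o 0 = st by store_ext.
exact: exec_done.
Qed.

Lemma copy_in ins o b st i : (forall r, r \in ins -> r < b) -> o < b ->
  o \notin ins -> st o = 0 -> (forall r, b <= r -> st r = 0) -> i < size ins ->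
  exec (copy_reg (nth 0 ins i) o b) st (upd st o (st (nth 0 ins i))).
Proof.
move=> insb ob oins sto stb isz.
have /insb xb : nth 0 ins i \in ins by exact: mem_nth.
apply: exec_copy_reg => //; last exact: stb.
- by apply: contraNneq oins => <-; exact: mem_nth.
- by rewrite ltn_eqF.
- by rewrite ltn_eqF.
Qed.

Lemma size_ins n (xs : n.-tuple nat) (st : nat -> nat) ins :
  tval xs = map st ins -> size ins = n.
Proof. by move=> e; rewrite -(size_tuple xs) e size_map. Qed.

Lemma compile_succ : compile_ok RSucc.
Proof.
move=> ins o b st xs v xsE insb ob oins sto stb /= ->.
have sz := size_ins xsE.
have -> : thead xs = st (nth 0 ins 0).
  by rewrite /thead (tnth_nth 0) xsE (nth_map 0) ?sz.
apply: exec_seq; first by apply: copy_in; rewrite // sz.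
have -> : upd st o (st (nth 0 ins 0)).+1 =
  let st1 := upd st o (st (nth 0 ins 0)) in upd st1 o (st1 o).+1 by store_ext.
exact: exec_inc_reg.
Qed.

Lemma compile_proj n i : compile_ok (@RProj n i).
Proof.
move=> ins o b st xs v xsE insb ob oins sto stb /= ->.
have sz := size_ins xsE.
by rewrite (tnth_nth 0) xsE (nth_map 0) ?sz //; apply: copy_in; rewrite ?sz.
Qed.

Definition upds st b (ys : seq nat) := fun r =>
  if (b <= r) && (r < b + size ys) then nth 0 ys (r - b) else st r.

Lemma upds_rcons st b ys y :
  upds st b (rcons ys y) = upd (upds st b ys) (b + size ys) y.
Proof.
apply: funext => r; rewrite /upd /upds size_rcons nth_rcons.
case: (r =P b + size ys) => [->|ne]; first by
  rewrite leq_addr addnS ltnS leqnn /= addKn ltnn eqxx.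
case: (boolP (b <= r < b + size ys)) => h.
  have -> : b <= r < b + (size ys).+1 by lia.
  by have -> : r - b < size ys by lia.
by rewrite ifF //; lia.
Qed.

Lemma map_upds st b ys ins :
  (forall r, r \in ins -> r < b) -> map (upds st b ys) ins = map st ins.
Proof.
move=> insb; apply/eq_in_map => r /insb rb.
by rewrite /upds leqNgt rb.
Qed.

Lemma exec_clears st b ys : (forall r, b <= r -> st r = 0) ->
  exec (seqps [seq clear_reg r | r <- iota b (size ys)]) (upds st b ys) st.
Proof.
move=> stb; elim: ys b stb => [|y ys IH] b stb /=.
  have -> : upds st b [::] = st.
    by apply: funext => r; rewrite /upds /= ifF //; lia.
  exact: exec_done.
apply: exec_seq (exec_clear_reg _ _) _.
have -> : upd (upds st b (y :: ys)) b 0 = upds st b.+1 ys.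
  apply: funext => r; rewrite /upd /upds /=; case: (r =P b) => [->|ne].
    by rewrite ltnn stb.
  case: (boolP (b < r < b.+1 + size ys)) => h.
    have -> : b <= r < b + (size ys).+1 by lia.
    by have -> : r - b = (r - b.+1).+1 by lia.
  by rewrite ifF //; lia.
by apply: IH => r br; apply: stb; lia.
Qed.

(** After the first [k] inner functions, the store contains the first [k]
    components of [ys] from register [b] on. *)
Lemma compile_comp m n (f : recfun m) (g : 'I_m -> recfun n) :
  compile_ok f -> (forall i, compile_ok (g i)) -> compile_ok (RComp f g).
Proof.
move=> okf okg ins o b st xs v xsE insb ob oins sto stb /= [ys [gys fv]].
have szys : size ys = m by rewrite size_tuple.
pose S k := upds st b (take k ys).
have args (l : seq 'I_m) k : k <= m ->
    map val l = iota k (m - k) ->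
    exec (seqps [seq compile (g i) ins (b + i) (b + m) | i <- l]) (S k) (S m).
  elim: l k => [|i l IH] k km /=.
    move=> /(congr1 size); rewrite size_iota /= => mk.
    have -> : k = m by lia.
    exact: exec_done.
  case mk : (m - k) => [|j] //= [ik lE].
  have ltk : k < m by lia.
  apply: exec_seq; last first.
    by apply: (IH k.+1) => //; rewrite lE; congr iota; lia.
  have -> : S k.+1 = upd (S k) (b + i) (tnth ys i).
    rewrite /S (take_nth 0) ?szys // upds_rcons size_takel ?szys ?ik //.
    by rewrite (tnth_nth 0) /= ik.
  have szt : size (take k ys) = k by rewrite size_takel ?szys.
  apply: (okg i _ _ _ _ xs); rewrite ?ik.
  - by rewrite xsE /S map_upds.
  - by move=> r /insb; lia.
  - by lia.
  - by apply: notin_ge insb _; lia.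
  - by rewrite /S /upds szt ltnn andbF stb //; lia.
  - by move=> r br; rewrite /S /upds szt ifF ?stb //; lia.
  - exact: gys.
apply: exec_seq (_ : exec _ _ (S m)) _.
  have {1}-> : st = S 0.
    by apply: funext => r; rewrite /S /upds take0 /= ifF //; lia.
  by apply: args; rewrite // val_enum_ord subn0.
have SmE : S m = upds st b ys by rewrite /S take_oversize ?szys.
have stob : upds (upd st o v) b ys = upd (upds st b ys) o v.
  apply: funext => r; rewrite /upd /upds; case: eqP => // ->.
  by rewrite ifF //; lia.
apply: exec_seq (_ : exec _ _ (upd (S m) o v)) _.
  apply: (okf _ _ _ _ ys); rewrite ?SmE.
  - apply: (@eq_from_nth _ 0); first by rewrite size_map size_iota szys.
    move=> i; rewrite szys => im.
    rewrite (nth_map 0) ?size_iota // nth_iota // /upds szys leq_addr ltn_add2l.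
    by rewrite im addKn.
  - by move=> r; rewrite mem_iota => /andP[].
  - by lia.
  - by rewrite mem_iota; lia.
  - by rewrite /upds ifF //; lia.
  - by move=> r br; rewrite /upds szys ifF ?stb //; lia.
  - exact: fv.
rewrite SmE -stob -{1}szys; apply: exec_clears => r br.
by rewrite /upd ifN ?stb //; lia.
Qed.

(** In front of round [i] of the loop, register [b] contains the number of
    remaining rounds, [b.+1] the index [i], and [o] the value at [i]. *)
Lemma compile_prec n (f : recfun n) (g : recfun n.+2) :
  compile_ok f -> compile_ok g -> compile_ok (RPrec f g).
Proof.
move=> okf okg [|x ins] o b st xs v xsE; first by have := size_ins xsE.
move=> insb ob oins sto stb /=.
have xb : x < b by apply: insb; rewrite inE eqxx.
have {}insb r : r \in ins -> r < b by move=> h; apply: insb; rewrite inE h orbT.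
move: oins; rewrite inE negb_or => /andP[ox oins].
have xsE' : tval [tuple of behead xs] = map st ins by rewrite /= xsE.
have -> : thead xs = st x by rewrite /thead (tnth_nth 0) xsE.
move=> /prec_graph_seq[y [yx fy gy]].
set k := st x in yx gy *.
pose S i := upd (upd (upd st b (k - i)) b.+1 i) o (y i).
have mapS i c w : b <= c -> map (upd (S i) c w) ins = map st ins.
  move=> bc; rewrite /S !map_upd //; apply: (notin_ge insb); lia.
have mapS' i : map (S i) ins = map st ins.
  by rewrite /S !map_upd //; apply: (notin_ge insb); lia.
apply: exec_seq (_ : exec _ _ (upd st b k)) _.
  by apply: exec_copy_reg; rewrite ?stb //; lia.
apply: exec_seq (_ : exec _ _ (S 0)) _.
  have -> : S 0 = upd (upd st b k) o (y 0)
    by rewrite /S subn0; store_ext; rewrite stb //; lia.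
  apply: (okf _ _ _ _ [tuple of behead xs]) => //.
  - by rewrite map_upd //; apply: (notin_ge insb); lia.
  - by move=> r /insb; lia.
  - by lia.
  - by rewrite /upd ifF //; lia.
  - by move=> r br; rewrite /upd ifF ?stb //; lia.
apply: exec_seq (_ : exec _ _ (S k)) _; last first.
  have -> : upd st o v = upd (S k) b.+1 0.
    by rewrite /S subnn yx; store_ext; rewrite stb //; lia.
  exact: exec_clear_reg.
have loopS j i : i + j = k -> exec (loop b (compile g [:: b.+1, o & ins] b.+2 b.+3 ;;
              clear_reg o ;; move_reg b.+2 o ;; inc_reg b.+1)) (S i) (S k).
  elim: j i => [|j IH] i ijk.
    have -> : i = k by lia.
    by apply: exec_loop0; rewrite /S /upd; do !case: eqP; lia.
  apply: (@exec_loopS _ _ _ j (S i.+1)); last by apply: IH; lia.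
    by rewrite /S /upd; do !case: eqP; lia.
  set S1 := upd (S i) b j.
  apply: exec_seq (_ : exec _ _ (upd S1 b.+2 (y i.+1))) _.
    apply: (okg _ _ _ _ [tuple of i :: y i :: [tuple of behead xs]]).
    - rewrite /= xsE' /S1 mapS //; congr [:: _, _ & _].
        by rewrite /S /upd; do !case: eqP; lia.
      by rewrite /S /upd; do !case: eqP; lia.
    - by move=> r; rewrite !inE => /or3P[/eqP->|/eqP->|/insb]; lia.
    - by lia.
    - rewrite !inE !negb_or (notin_ge insb) ?andbT; lia.
    - by rewrite /S1 /S /upd; do !case: eqP; try lia; move=> *; rewrite stb //; lia.
    - by move=> r br; rewrite /S1 /S /upd !ifF ?stb //; lia.
    - by apply: gy; lia.
  apply: exec_seq (exec_clear_reg _ _) _.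
  apply: exec_seq (exec_move_reg _ _) _; first by lia.
  set S2 := upd (upd _ _ _) _ _.
  have S2b : S2 b.+1 = i by rewrite /S2 /S1 /S /upd; do !case: eqP; lia.
  have -> : S i.+1 = upd S2 b.+1 (S2 b.+1).+1.
    rewrite S2b /S2 /S1 /S /upd; apply: funext => r; rewrite !eqxx.
    do !case: eqP => // ?; first [by rewrite ?stb //; lia|congruence].
  exact: exec_inc_reg.
exact: (loopS k).
Qed.

(** In front of round [i] of the loop, register [b] contains the candidate [i]
    and [b.+1] the value of [f] at [i]; the loop stops when this value is
    [0]. *)
Lemma compile_mu n (f : recfun n.+1) : compile_ok f -> compile_ok (RMu f).
Proof.
move=> okf ins o b st xs v xsE insb ob oins sto stb /= [fv fy].
have val i : exists w, i <= v -> rec_graph f [tuple of i :: xs] w /\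
    (if i < v then w != 0 else w == 0).
  case: (ltngtP i v) => [h|h|->].
  - by have [w fw] := fy _ h; exists w.+1.
  - by exists 0.
  - by exists 0.
have {val fv fy} /choice[y yP] := val.
pose S i := upd (upd st b i) b.+1 (y i).
have run i w : i <= v -> st b.+1 = 0 -> w = 0 ->
    exec (compile f (b :: ins) b.+1 b.+2) (upd (upd st b i) b.+1 w) (S i).
  move=> iv _ ->; have [fi _] := yP i iv.
  have -> : S i = upd (upd (upd st b i) b.+1 0) b.+1 (y i) by rewrite /S; store_ext.
  apply: (okf _ _ _ _ [tuple of i :: xs]) => //=.
  - by rewrite !map_upd ?(notin_ge insb) // xsE /upd /= eqxx ltn_eqF.
  - by move=> r; rewrite inE => /orP[/eqP->|/insb]; lia.
  - by rewrite inE negb_or (notin_ge insb) ?andbT; lia.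
  - by rewrite /upd eqxx.
  - by move=> r br; rewrite /upd !ifF ?stb //; lia.
have stb1 : st b.+1 = 0 by apply: stb; lia.
apply: exec_seq (_ : exec _ _ (S 0)) _.
  have {1}-> : st = upd (upd st b 0) b.+1 0 by store_ext; rewrite stb //; lia.
  exact: run.
apply: exec_seq (_ : exec _ _ (S v)) _; last first.
  have yv : y v = 0 by have [_] := yP v (leqnn v); rewrite ltnn => /eqP.
  have -> : upd st o v = upd (upd (S v) o (S v o + S v b)) b 0.
    rewrite /S yv /upd; apply: funext => r; rewrite !eqxx.
    do !case: eqP => // ?; first [congruence|by rewrite ?sto ?stb //; lia].
  by apply: exec_move_reg; lia.
have loopS j i : i + j = v -> exec (loop b.+1 (clear_reg b.+1 ;; inc_reg b ;;
    compile f (b :: ins) b.+1 b.+2)) (S i) (S v).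
  elim: j i => [|j IH] i ijv.
    have -> : i = v by lia.
    apply: exec_loop0; rewrite /S /upd eqxx.
    by have [_] := yP v (leqnn v); rewrite ltnn => /eqP.
  have [_] := yP i ltac:(lia); have -> : i < v by lia.
  case yi : (y i) => [|w] // _.
  apply: (@exec_loopS _ _ _ w (S i.+1)); last by apply: IH; lia.
    by rewrite /S /upd eqxx.
  apply: exec_seq (exec_clear_reg _ _) _.
  apply: exec_seq (exec_inc_reg _ _) _.
  set s := upd _ _ _.
  have -> : s = upd (upd st b i.+1) b.+1 0.
    rewrite /s /S /upd; apply: funext => r; rewrite !eqxx.
    do !case: eqP => // ?; first [lia|congruence].
  by apply: run => //; lia.
exact: (loopS v).
Qed.

Lemma compile_exec n (f : recfun n) : compile_ok f.
Proof.
elim: f => [?||? ?|? ? ? ? ? ?|? ? ? ? ?|? ? ?].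
- exact: compile_zero.
- exact: compile_succ.
- exact: compile_proj.
- exact: compile_comp.
- exact: compile_prec.
- exact: compile_mu.
Qed.
End CompileExec.

(** * Stack machines *)

(** The control part of a machine working on stacks of booleans.  [Pop] removes
    a top letter [true] and goes to its first state; on a top letter [false] it
    leaves the stack as it is and goes to its second state. *)
Inductive instr (Q R : Type) :=
| Push of R & Q
| Pop of R & Q & Q
| Halt.
Arguments Halt {Q R}.

Section Machine.
Variables (Q R : finType) (delta : Q -> instr Q R).

Definition stacks := {ffun R -> seq bool}.
Definition conf := (stacks * Q)%type.

Definition set_stack (w : stacks) r s : stacks :=
  [ffun i => if i == r then s else w i].

Definition mstep (c : conf) : option conf :=
  let: (w, q) := c in
  match delta q with
  | Push r q' => Some (set_stack w r (true :: w r), q')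
  | Pop r q1 q0 => match w r with
      | true :: s => Some (set_stack w r s, q1)
      | false :: _ => Some (w, q0)
      | [::] => None
      end
  | Halt => None
  end.

Definition halts (c : conf) : Prop :=
  exists w q, reach mstep c (w, q) /\ delta q = Halt.

(** The letter [false] marks the bottom of a stack, so that [Pop] is a
    decrement with zero test. *)
Definition unary (rho : R -> nat) : stacks :=
  [ffun r => rcons (nseq (rho r) true) false].
End Machine.

HB.instance Definition _ := gen_eqMixin prog.
HB.instance Definition _ := gen_choiceMixin prog.

Definition successors p := match p with
  | Done => [::]
  | Inc r k => [:: k]
  | Loop r b k => [:: b ;; p; k]
  end.

(** The programs that can remain to be executed while [p] is run in front of
    [k], as long as [k] is not reached: they provide finitely many control
    states. *)
Fixpoint continuations p k := match p with
  | Done => [::]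
  | Inc r p' => (p ;; k) :: continuations p' k
  | Loop r b p' => (p ;; k) :: continuations b (p ;; k) ++ continuations p' k
  end.

Lemma continuations_head p k : (p ;; k) \in k :: continuations p k.
Proof.
by case: p => [|r p|r b p]; [exact: mem_head| |]; rewrite /= !inE eqxx orbT.
Qed.

Lemma continuations_successors p k q q' :
  q \in continuations p k -> q' \in successors q -> q' \in k :: continuations p k.
Proof.
have widen (x y : prog) s s' : {subset s <= s'} -> x \in y :: s -> x \in y :: s'.
  by move=> ss'; rewrite !in_cons => /orP[->//|/ss' ->]; rewrite orbT.
elim: p k => [|r p IH|r b IHb p IHp] k //.
  rewrite [continuations _ _]/= in_cons => /orP[/eqP->|/IH h /h].
    rewrite mem_seq1 => /eqP ->; apply: widen (continuations_head p k) => x xs.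
    by rewrite in_cons xs orbT.
  by apply: widen => x xs; rewrite in_cons xs orbT.
rewrite [continuations _ _]/=; set me := Loop r b p ;; k.
rewrite in_cons mem_cat => /or3P[/eqP->|/IHb h /h|/IHp h /h].
- rewrite !in_cons orbF => /orP[]/eqP->.
    have := continuations_head b me; rewrite -/me !in_cons mem_cat.
    by case/orP=> ->; rewrite ?orbT.
  have := continuations_head p k; rewrite !in_cons mem_cat.
  by case/orP=> ->; rewrite ?orbT.
- rewrite !in_cons mem_cat => /orP[] ->; rewrite ?orbT //.
- by rewrite !in_cons mem_cat => /orP[] ->; rewrite ?orbT.
Qed.

Fixpoint bounded K p := match p with
  | Done => true
  | Inc r k => (r < K) && bounded K k
  | Loop r b k => [&& r < K, bounded K b & bounded K k]
  end.

Lemma bounded_seqp K p k : bounded K (p ;; k) = bounded K p && bounded K k.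
Proof. by elim: p => //= [r p ->|r b _ p ->]; rewrite -!andbA. Qed.

Lemma bounded_continuations K p k q : bounded K p -> bounded K k -> q \in continuations p k ->
  bounded K q.
Proof.
elim: p k => [|r p IH|r b IHb p IHp] k //=.
  move=> /andP[rK pK] kK; rewrite inE => /orP[/eqP->|]; last exact: IH.
  by rewrite bounded_seqp /= rK pK.
move=> /and3P[rK bK pK] kK.
have meK : bounded K (Loop r b p ;; k) by rewrite bounded_seqp /= rK bK pK.
rewrite inE mem_cat => /or3P[/eqP->|/IHb|/IHp] //; exact.
Qed.

Lemma bounded_exists p : exists K, forall K', K <= K' -> bounded K' p.
Proof.
elim: p => [|r p [K pK]|r b [K bK] p [K' pK]]; first by exists 0.
- exists (maxn r.+1 K) => K'; rewrite geq_max /= => /andP[-> /pK ->] //.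
- exists (maxn r.+1 (maxn K K')) => K''; rewrite !geq_max /=.
  by move=> /and3P[-> /bK -> /pK ->].
Qed.

Section OfProg.
Variables (P : prog) (K : nat).
Hypothesis PK : bounded K.+2 P.

Definition states := Done :: continuations P Done.

Lemma Done_states : Done \in states. Proof. by rewrite inE eqxx. Qed.

Definition to_state p : seq_sub states := insubd (SeqSub Done_states) p.

Lemma to_stateK p : p \in states -> ssval (to_state p) = p.
Proof. by move=> pS; rewrite /to_state -[ssval _]/(val _) insubdK. Qed.

Definition prog_delta (q : seq_sub states) : instr (seq_sub states) 'I_K.+2 :=
  match ssval q with
  | Done => Halt
  | Inc r k => Push (inord r) (to_state k)
  | Loop r b k => Pop (inord r) (to_state (b ;; ssval q)) (to_state k)
  end.

Definition prog_conf (c : prog * (nat -> nat)) : conf _ 'I_K.+2 :=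
  (unary (fun r : 'I_K.+2 => c.2 r), to_state c.1).

Lemma states_bounded p : p \in states -> bounded K.+2 p.
Proof. by rewrite inE => /orP[/eqP->//|]; exact: bounded_continuations. Qed.

Lemma states_succs p p' : p \in states -> p' \in successors p -> p' \in states.
Proof. by rewrite inE => /orP[/eqP->//|]; exact: continuations_successors. Qed.

Lemma set_unary (st : nat -> nat) r v s : r < K.+2 -> s = rcons (nseq v true) false ->
  set_stack (unary (fun i : 'I_K.+2 => st i)) (inord r) s =
  unary (fun i : 'I_K.+2 => upd st r v i).
Proof.
move=> rK ->; apply/ffunP => i; rewrite !ffunE /upd -val_eqE /= inordK //.
by case: eqP.
Qed.

Lemma prog_sim p st p' st' : p \in states -> pstep (p, st) = Some (p', st') ->
  mstep prog_delta (prog_conf (p, st)) = Some (prog_conf (p', st')) /\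
  p' \in states.
Proof.
move=> pS; have := states_bounded pS; have sS := states_succs pS.
rewrite /= /prog_delta to_stateK //.
case: p pS sS => [|r k|r b k] pS sS //=.
  move=> /andP[rK _] [<- <-]; split; last by apply: sS; rewrite inE.
  congr (Some (_, _)); apply: set_unary => //.
  by rewrite ffunE inordK.
move=> /and3P[rK _ _]; rewrite ffunE inordK //.
case: (st r) => [|n] [<- <-] /=; split => //.
- by apply: sS; rewrite !inE eqxx orbT.
- by congr (Some (_, _)); exact: set_unary.
- by apply: sS; rewrite !inE eqxx.
Qed.

Lemma prog_reach p st p' st' : p \in states -> reach pstep (p, st) (p', st') ->
  reach (mstep prog_delta) (prog_conf (p, st)) (prog_conf (p', st')) /\
  p' \in states.
Proof.
move=> pS r; move: pS.
apply: (@reach_elim _ pstep (fun c => c.1 \in states ->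
  reach (mstep prog_delta) (prog_conf c) (prog_conf (p', st')) /\ p' \in states)
  (p', st') _ _ (p, st)) => //= [p'S|[p1 st1] [p2 st2] e IH /= p1S].
  by split=> //; exact: reach_refl.
have [s1 p2S] := prog_sim p1S e; have [r1 p'S] := IH p2S; split => //.
by apply: reach_trans r1; exact: reach_step.
Qed.
End OfProg.

(** A final loop that decrements and increments the register of the answer
    runs forever unless the answer is [0].  By determinism it is enough to know
    how the program runs when [g] is defined. *)
Theorem recfun_machine (g : recfun 2) :
  exists (Q R : finType) (delta : Q -> instr Q R) (r0 r1 : R) (q0 : Q),
  r0 != r1 /\ forall n m,
    let c0 := (unary (fun r => if r == r0 then n else if r == r1 then m else 0), q0)
    in (rec_graph g [tuple n; m] 0 -> halts delta c0) /\
       (rec_graph g [tuple n; m] 1 -> ~ halts delta c0).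
Proof.
(* Inputs in registers 0 and 1, answer in register 2. *)
pose L := loop 2 (inc_reg 2).
pose P := compile g [:: 0; 1] 2 3 ;; L.
have [K PK] := bounded_exists P.
have {}PK : bounded K.+2 P by apply: PK; lia.
pose delta := @prog_delta P K.
exists (seq_sub (states P) : finType), 'I_K.+2, delta, ord0, (lift ord0 ord0),
  (to_state P P); split => // n m c0.
pose st i := if i == 0 then n else if i == 1 then m else 0.
have PS : P \in states P.
  by have := continuations_head P Done; rewrite seqp_done.
have -> : c0 = prog_conf P K (P, st).
  by congr (_, _); apply/ffunP => r; rewrite !ffunE -!val_eqE.
have run v : rec_graph g [tuple n; m] v ->
    reach (mstep delta) (prog_conf P K (P, st)) (prog_conf P K (L, upd st 2 v))
    /\ L \in states P.
  move=> gv; apply: prog_reach => //.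
  apply: (compile_exec (xs := [tuple n; m])) => //.
  - by move=> r; rewrite !inE => /orP[]/eqP->.
  - by case=> [|[|[|r]]].
split=> /run[r1 LS].
  have sD : pstep (L, upd st 2 0) = Some (Done, upd st 2 0) by [].
  have [r2 DS] := prog_sim PK LS sD.
  exists (prog_conf P K (Done, upd st 2 0)).1, (to_state P Done).
  split; first exact: reach_trans r1 (reach_step r2).
  by rewrite /delta /prog_delta to_stateK.
move=> [w [q [r hq]]].
have s1 : pstep (L, upd st 2 1) = Some (Inc 2 L, upd st 2 0).
  by congr (Some (_, _)); store_ext.
have s2 : pstep (Inc 2 L, upd st 2 0) = Some (L, upd st 2 1).
  by congr (Some (_, _)); store_ext.
have [t1 IS] := prog_sim PK LS s1.
have [t2 _] := prog_sim PK IS s2.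
have hstuck : mstep delta (w, q) = None by rewrite /= hq.
have [r'|r'] := reach_linear r r1.
  have e := reach_stuck hstuck r'.
  by move: hstuck; rewrite -e t1.
exact: cycle_not_stuck t1 (reach_step t2) r' hstuck.
Qed.

(** * Computability of the pairing function *)

Definition computable n (F : n.-tuple nat -> nat) : Prop :=
  exists f : recfun n, forall xs, rec_graph f xs (F xs).

Definition computable1 (G : nat -> nat) :=
  computable (fun t : 1.-tuple nat => G (tnth t ord0)).

Definition computable2 (G : nat -> nat -> nat) :=
  computable (fun t : 2.-tuple nat => G (tnth t ord0) (tnth t ord_max)).

Lemma computable_proj n (i : 'I_n) : computable (fun xs => tnth xs i).
Proof. by exists (RProj i). Qed.

Lemma computable_comp m n (G : m.-tuple nat -> nat)
    (F : 'I_m -> n.-tuple nat -> nat) :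
  computable G -> (forall i, computable (F i)) ->
  computable (fun xs => G [tuple F i xs | i < m]).
Proof.
move=> [g gP] /choice[f fP]; exists (RComp g f) => xs /=.
by exists [tuple F i xs | i < m]; split => // i; rewrite tnth_mktuple.
Qed.

Lemma computable_comp1 n G (F : n.-tuple nat -> nat) :
  computable1 G -> computable F -> computable (fun xs => G (F xs)).
Proof.
move=> cG cF; have [f fP] := computable_comp cG (fun=> cF).
by exists f => xs; have := fP xs; rewrite tnth_mktuple.
Qed.

Lemma computable_comp2 n G (F F' : n.-tuple nat -> nat) :
  computable2 G -> computable F -> computable F' ->
  computable (fun xs => G (F xs) (F' xs)).
Proof.
move=> cG cF cF'.
have cFF' (i : 'I_2) : computable (if i == ord0 then F else F') by case: ifP.
have [f fP] := computable_comp cG cFF'.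
by exists f => xs; have := fP xs; rewrite !tnth_mktuple.
Qed.

Lemma computable_succ n (F : n.-tuple nat -> nat) :
  computable F -> computable (fun xs => (F xs).+1).
Proof. by apply: computable_comp1; exists RSucc. Qed.

Lemma computable_const n c : computable (fun _ : n.-tuple nat => c).
Proof.
by elim: c => [|c IH]; [exists (RZero n)|exact: computable_succ IH].
Qed.

(** Primitive recursion in which the step ignores the parameters. *)
Lemma computable_iteri n G (K B : n.-tuple nat -> nat) :
  computable2 G -> computable K -> computable B ->
  computable (fun xs => iteri (K xs) G (B xs)).
Proof.
move=> [g gP] [k kP] [b bP].
pose h : recfun n.+1 := RPrec b
  (RComp g (fun i : 'I_2 => RProj (if i == ord0 then ord0 else lift ord0 ord0))).
exists (RComp h (fun i => if unlift ord0 i is Some j then RProj j else k)) => xs.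
exists [tuple of K xs :: xs]; split.
  move=> i; case: unliftP => [j ->|->] /=; last by rewrite tnth0.
  by rewrite tnthS.
rewrite /= theadE; have -> : [tuple of behead (K xs :: xs)] = xs.
  by apply: val_inj.
elim: (K xs) => [|j IH] /=; first exact: bP.
exists (iteri j G (B xs)); split => //.
exists [tuple j; iteri j G (B xs)]; split; last exact: gP.
by case=> [[|[|i]] ilt] //=; rewrite !(tnth_nth 0).
Qed.

Lemma computable_iter n G (K B : n.-tuple nat -> nat) :
  computable1 G -> computable K -> computable B ->
  computable (fun xs => iter (K xs) G (B xs)).
Proof.
move=> cG cK cB.
have cG' : computable2 (fun _ => G) by apply: computable_comp1 cG (computable_proj _).
have [f fP] := computable_iteri cG' cK cB; exists f => xs.
suff -> : iter (K xs) G (B xs) = iteri (K xs) (fun _ => G) (B xs) by [].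
by elim: (K xs) => //= j ->.
Qed.

Lemma computable_add : computable2 addn.
Proof.
have cS : computable1 succn by exact: computable_succ (computable_proj _).
have [f fP] := computable_iter cS (@computable_proj 2 ord0) (computable_proj ord_max).
by exists f => xs; have := fP xs; rewrite iter_succn addnC.
Qed.

Lemma computable_cpair : computable2 cpair.
Proof.
have cs : computable (fun t : 2.-tuple nat => (tnth t ord0 + tnth t ord_max).+1).
  exact: computable_succ computable_add.
have cG : computable2 (fun k y => y + k).
  by apply: computable_comp2 computable_add _ _; exact: computable_proj.
have ct := computable_iteri cG cs (computable_const 2 0).
have [f fP] := computable_comp2 computable_add ct (computable_proj ord_max).
exists f => xs; have := fP xs.
suff E n : iteri n (fun k y => y + k) 0 = 'C(n, 2) by rewrite E.
by elim: n => //= n ->; rewrite binS bin1.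
Qed.

(** * Coding a stack machine by lattice inequalities *)

Section Polynomials.
Variables (X : Type) (mt jn : X -> X -> X) (fx : nat -> X).

(** The image of [y] under [f], seen as a linear relation with values in
    [Z]. *)
Definition rel_image y f Z := mt (jn y f) Z.
(** The generators [fx i] have numbers that do not depend on the machine.
    Here [fx 0] stands for the bottom, [fx 1], [fx 2], [fx 3] for the independent
    elements, [fx 4] and [fx 5] for the ways back from [B] to [C] and from [C] to [A],
    [fx 6] for the relation that spreads the start configuration over [B], and
    [fx 7] is free.  The generators [fx 8] to [fx 12] are bounded above by the pieces of the
    start configuration; see [alias_ineqs]. *)
Definition g_bot := fx 0.
Definition g_A := fx 1.
Definition g_B := fx 2.
Definition g_C := fx 3.
Definition g_d := fx 4.
Definition g_e := fx 5.
Definition g_r := fx 6.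
Definition g_base := fx 8.

(** The relation [l] goes from [A] to [B]; the detour through [C] turns it into
    an action on the elements below [A]. *)
Definition letter_act l y := rel_image (rel_image (rel_image y l g_B) g_d g_C) g_e g_A.

(** The composite relation from [A] to [B] that applies [l], goes back to [A]
    through [C], and then applies [l'].  Going from [A] to [C] and then from [C]
    to [B] keeps every composition between three different elements. *)
Definition two_letters l l' :=
  mt (jn (mt (jn l g_d) (jn g_A g_C)) (mt (jn g_e l') (jn g_C g_B))) (jn g_A g_B).

(** The start configuration with inputs [n] and [m] spreads over [B].  Only
    fixed generators occur, so that the code of this relation can be computed
    from [n] and [m] alone. *)
Definition start_ineq n m :=
  (g_B,
   jn (letter_act (fx 10) (iter n (letter_act (fx 9))
        (letter_act (fx 12) (iter m (letter_act (fx 11)) g_base)))) g_r).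

Section Relations.
Variables (Q R : finType) (delta : Q -> instr Q R) (r0 r1 : R) (q0 : Q).
Variables (lt : R * bool -> X) (st : Q -> X).

Definition other_regs := [seq r <- enum R | r \notin [:: r0; r1]].

Definition frame_ineqs : seq (X * X) :=
  [:: (mt (jn g_A g_B) (jn g_B g_C), g_B);
      (mt (jn g_C g_A) (jn g_A g_B), g_A);
      (mt (jn g_A g_C) (jn g_C g_B), g_C);
      (g_d, jn g_B g_C); (g_e, jn g_C g_A);
      (g_C, jn g_B g_d); (g_A, jn g_C g_e);
      (rel_image g_bot g_d g_C, g_bot); (rel_image g_bot g_e g_A, g_bot);
      (rel_image g_bot g_r g_B, g_bot)].

(** The action is monotone, hence bounding the fixed generators by the letters
    and the stack contents that they replace bounds the start configuration. *)
Definition alias_ineqs : seq (X * X) :=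
  [:: (g_base, foldr (fun r => letter_act (lt (r, false))) (st q0) other_regs);
      (fx 9, lt (r0, true)); (fx 10, lt (r0, false));
      (fx 11, lt (r1, true)); (fx 12, lt (r1, false))].

Definition gen_values :=
  [seq fx i | i <- iota 0 13] ++ [seq lt l | l <- enum {: R * bool}]
    ++ [seq st q | q <- enum Q].

Definition letter_ineqs l : seq (X * X) :=
  [:: (lt l, jn g_A g_B); (rel_image g_bot (lt l) g_B, g_bot)].

Definition comm_ineq (p : (R * bool) * (R * bool)) : X * X :=
  if p.1.1 == p.2.1 then (g_bot, g_bot)
  else (two_letters (lt p.1) (lt p.2), two_letters (lt p.2) (lt p.1)).

Definition instr_ineqs q : seq (X * X) :=
  match delta q with
  | Push r q' => [:: (st q, letter_act (lt (r, true)) (st q'))]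
  | Pop r q1 q2 => [:: (letter_act (lt (r, true)) (st q), st q1);
       (letter_act (lt (r, false)) (st q), letter_act (lt (r, false)) (st q2))]
  | Halt => [:: (st q, g_bot)]
  end.

(** The relations are written over an arbitrary carrier with two binary
    operations because they are needed for lattice terms, for elements of a
    lattice and, in the case of [start_ineq], for codes. *)
Definition machine_ineqs : seq (X * X) :=
  frame_ineqs ++ alias_ineqs
  ++ [seq (g_bot, x) | x <- gen_values]
  ++ [seq (x, jn (jn g_A g_B) g_C) | x <- gen_values]
  ++ flatten [seq letter_ineqs l | l <- enum {: R * bool}]
  ++ [seq comm_ineq p | p <- enum {: (R * bool) * (R * bool)}]
  ++ [seq (st q, g_A) | q <- enum Q]
  ++ flatten [seq instr_ineqs q | q <- enum Q].
End Relations.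
End Polynomials.

Section Naturality.
Variables (X Y : Type) (mt jn : X -> X -> X) (mt' jn' : Y -> Y -> Y).
Variables (h : X -> Y).
Hypothesis h_mt : forall x y, h (mt x y) = mt' (h x) (h y).
Hypothesis h_jn : forall x y, h (jn x y) = jn' (h x) (h y).
Variables (fx : nat -> X).

Let h2 (p : X * X) := (h p.1, h p.2).

Lemma act_nat l y : h (letter_act mt jn fx l y) = letter_act mt' jn' (h \o fx) (h l) (h y).
Proof. by rewrite /letter_act /rel_image !(h_mt, h_jn). Qed.

Lemma start_nat n m : h2 (start_ineq mt jn fx n m) = start_ineq mt' jn' (h \o fx) n m.
Proof.
rewrite /start_ineq /h2 /= h_jn act_nat; congr (_, jn' (letter_act _ _ _ _ _) _).
have itn k l y : h (iter k (letter_act mt jn fx l) y) =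
    iter k (letter_act mt' jn' (h \o fx) (h l)) (h y).
  by elim: k => //= k IH; rewrite act_nat IH.
by rewrite itn act_nat itn.
Qed.

Variables (Q R : finType) (delta : Q -> instr Q R) (r0 r1 : R) (q0 : Q).
Variables (lt : R * bool -> X) (st : Q -> X).

Lemma ineqs_nat : map h2 (machine_ineqs mt jn fx delta r0 r1 q0 lt st) =
  machine_ineqs mt' jn' (h \o fx) delta r0 r1 q0 (h \o lt) (h \o st).
Proof.
have gensE : map h (gen_values fx lt st) = gen_values (h \o fx) (h \o lt) (h \o st).
  by rewrite /gen_values !map_cat -!map_comp.
rewrite /machine_ineqs -!gensE; move: (gen_values fx lt st) {gensE} => gs.
rewrite !map_cat !map_flatten -!map_comp.
congr (_ ++ (_ ++ (_ ++ (_ ++ (flatten _ ++ (_ ++ (_ ++ flatten _))))))).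
- by rewrite /frame_ineqs /h2 /= /rel_image !(h_mt, h_jn).
- rewrite /alias_ineqs /h2 /=; congr ((_, _) :: _).
  by elim: (other_regs r0 r1) => //= r s IH; rewrite act_nat IH.
- by apply: eq_map => x /=; rewrite /h2 /= !h_jn.
by apply: eq_map => l; rewrite /letter_ineqs /h2 /= /rel_image !(h_mt, h_jn).
- apply: eq_map => p; rewrite /comm_ineq /h2 /=; case: ifP => //= _.
  by rewrite /two_letters !(h_mt, h_jn).
- apply: eq_map => q; rewrite /instr_ineqs /=.
  by case: (delta q) => [r q'|r q1 q2|] /=; rewrite /h2 /= ?act_nat.
Qed.
End Naturality.

Lemma all_flatten (T : Type) (a : pred T) ss : all a (flatten ss) = all (all a) ss.
Proof. by elim: ss => //= s ss IH; rewrite all_cat IH. Qed.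

Section Derivation.
Local Open Scope order_scope.
Variables (d : Order.disp_t) (L : latticeType d).
Hypothesis L_modular : modular L.

Local Notation ap := (rel_image (@Order.meet d L) (@Order.join d L)).

Lemma rel_image_mono (y y' f f' Z : L) : y <= y' -> f <= f' -> ap y f Z <= ap y' f' Z.
Proof. by move=> yy ff; apply: leI2 => //; exact: leU2. Qed.

(** This is where modularity is used: applying a composite relation is
    applying its two factors in turn. *)
Lemma rel_image_comp (y f g A B C : L) : y <= A -> f <= A `|` B -> g <= B `|` C ->
  (A `|` B) `&` (B `|` C) <= B ->
  ap y ((f `|` g) `&` (A `|` C)) C = ap (ap y f B) g C.
Proof.
move=> yA fAB gBC ind; rewrite /rel_image.
rewrite (L_modular (f `|` g) (le_trans yA (leUl A C))).
rewrite -meetA (meet_idPr (leUr C A) : (A `|` C) `&` C = C).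
have yfAB : y `|` f <= A `|` B by rewrite leUx fAB (le_trans yA (leUl _ _)).
have -> : (y `|` f) `&` B = (y `|` f) `&` (B `|` C).
  apply/le_anti/andP; split; first by apply: leI2 => //; exact: leUl.
  rewrite lexI leIl /=; apply: le_trans ind; apply: leI2 => //.
rewrite [in RHS]joinC (L_modular _ gBC) -meetA (meet_idPr (leUr C B) : (B `|` C) `&` C = C).
by rewrite joinA [_ `|` g]joinC.
Qed.

Variables (Q R : finType) (delta : Q -> instr Q R) (r0 r1 : R) (q0 : Q).
Variables (fx : nat -> L) (lt : R * bool -> L) (st : Q -> L).
Hypothesis r01 : r0 != r1.

Local Notation act := (letter_act (@Order.meet d L) (@Order.join d L) fx).
Local Notation two := (two_letters (@Order.meet d L) (@Order.join d L) fx).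
Local Notation A := (g_A fx).
Local Notation B := (g_B fx).
Local Notation C := (g_C fx).
Local Notation bot := (g_bot fx).

Hypothesis rels : all (fun p => p.1 <= p.2)
  (machine_ineqs (@Order.meet d L) (@Order.join d L) fx delta r0 r1 q0 lt st).

Lemma act_mono l l' y y' : l <= l' -> y <= y' -> act l y <= act l' y'.
Proof. by move=> ll yy; rewrite /letter_act; do !apply: rel_image_mono => //. Qed.

Lemma act_A l y : act l y <= A.
Proof. exact: leIr. Qed.

Lemma frame_rels : all (fun p => p.1 <= p.2)
  (frame_ineqs (@Order.meet d L) (@Order.join d L) fx).
Proof. by move: rels; rewrite !all_cat => /andP[]. Qed.

Lemma alias_rels : all (fun p => p.1 <= p.2)
  (alias_ineqs (@Order.meet d L) (@Order.join d L) fx r0 r1 q0 lt st).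
Proof. by move: rels; rewrite !all_cat => /and3P[]. Qed.

Lemma gens_bot x : x \in gen_values fx lt st -> bot <= x.
Proof.
move: rels; rewrite !all_cat => /and4P[_ _ + _];
  rewrite all_map => /allP h; exact: h.
Qed.

Lemma gens_top x : x \in gen_values fx lt st -> x <= A `|` B `|` C.
Proof.
move: rels; rewrite !all_cat => /and5P[_ _ _ + _];
  rewrite all_map => /allP h; exact: h.
Qed.

Lemma letter_rels l : lt l <= A `|` B /\ ap bot (lt l) B <= bot.
Proof.
move: rels; rewrite !all_cat => /and5P[_ _ _ _ /andP[+ _]].
rewrite all_flatten all_map => /allP/(_ l); rewrite mem_enum => /(_ isT) /=.
by rewrite andbT => /andP[].
Qed.

Lemma comm_rels l l' : l.1 != l'.1 -> two (lt l) (lt l') <= two (lt l') (lt l).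
Proof.
move: rels; rewrite !all_cat => /and5P[_ _ _ _ /and3P[_ + _]].
rewrite all_map => /allP/(_ (l, l')); rewrite mem_enum => /(_ isT) /=.
by rewrite /comm_ineq /=; case: ifP.
Qed.

Lemma state_rels q : st q <= A.
Proof.
move: rels; rewrite !all_cat => /and5P[_ _ _ _ /and4P[_ _ + _]].
by rewrite all_map => /allP/(_ q); rewrite mem_enum => /(_ isT).
Qed.

Lemma instr_rels q : all (fun p => p.1 <= p.2)
  (instr_ineqs (@Order.meet d L) (@Order.join d L) fx delta lt st q).
Proof.
move: rels; rewrite !all_cat => /and5P[_ _ _ _ /and4P[_ _ _]].
by rewrite all_flatten all_map => /allP/(_ q); rewrite mem_enum => /(_ isT).
Qed.

(** Both double actions are the image under a composite relation from [A] to
    [B], followed by the same way back to [A]; the relations compare the two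
    composites. *)
Lemma act_comm_le l l' y : l.1 != l'.1 -> y <= A ->
  act (lt l') (act (lt l) y) <= act (lt l) (act (lt l') y).
Proof.
move=> ll yA.
have /and5P[iB iA iC dBC /andP[eCA _]] := frame_rels.
have twoE m m' : ap y (two (lt m) (lt m')) B = ap (act (lt m) y) (lt m') B.
  have [mAB _] := letter_rels m; have [m'AB _] := letter_rels m'.
  rewrite /two_letters (@rel_image_comp _ _ _ A C B) //; last 2 first.
  - exact: leIr.
  - exact: leIr.
  rewrite (@rel_image_comp _ _ _ A B C) //.
  by rewrite (@rel_image_comp _ _ _ C A B) //; exact: leIr.
rewrite /letter_act -!twoE; do 3![apply: rel_image_mono => //].
exact: comm_rels.
Qed.

Lemma act_comm l l' y : l.1 != l'.1 -> y <= A ->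
  act (lt l') (act (lt l) y) = act (lt l) (act (lt l') y).
Proof.
by move=> ll yA; apply/le_anti; rewrite !act_comm_le // eq_sym.
Qed.

Definition word r s y := foldl (fun y b => act (lt (r, b)) y) y s.
Definition words rs (w : R -> seq bool) y := foldr (fun r => word r (w r)) y rs.

Lemma word_cons r b s y : word r (b :: s) y = word r s (act (lt (r, b)) y).
Proof. by []. Qed.

Lemma word_A r s y : y <= A -> word r s y <= A.
Proof. by elim: s y => //= b s IH y yA; apply: IH; exact: act_A. Qed.

Lemma words_A rs w y : y <= A -> words rs w y <= A.
Proof. by move=> yA; elim: rs => //= r rs; exact: word_A. Qed.

Lemma word_mono r s y y' : y <= y' -> word r s y <= word r s y'.
Proof. by elim: s y y' => //= b s IH y y' yy'; apply: IH; exact: act_mono. Qed.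

Lemma words_mono rs w y y' : y <= y' -> words rs w y <= words rs w y'.
Proof. by move=> yy'; elim: rs => //= r rs; exact: word_mono. Qed.

Lemma act_word r r' b s y : r != r' -> y <= A ->
  act (lt (r, b)) (word r' s y) = word r' s (act (lt (r, b)) y).
Proof.
move=> rr'; elim: s y => //= b' s IH y yA.
by rewrite IH ?act_A // act_comm // eq_sym.
Qed.

Lemma word_comm r r' s s' y : r != r' -> y <= A ->
  word r s (word r' s' y) = word r' s' (word r s y).
Proof.
move=> rr'; elim: s y => //= b s IH y yA.
by rewrite act_word // IH // act_A.
Qed.

Lemma word_words r s rs w y : r \notin rs -> y <= A ->
  word r s (words rs w y) = words rs w (word r s y).
Proof.
move=> + yA; elim: rs => //= r' rs IH; rewrite inE negb_or => /andP[rr' rrs].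
by rewrite word_comm ?IH // words_A.
Qed.

(** Any stack can be moved next to the control state, where the instructions
    act. *)
Lemma words_pull r rs w y : uniq rs -> r \in rs -> y <= A ->
  words rs w y = words (rem r rs) w (word r (w r) y).
Proof.
move=> + + yA; elim: rs => //= r' rs IH /andP[r'rs uniq_rs].
rewrite inE; case: eqP => [->|/eqP rr'] /=; first by rewrite eqxx word_words.
by move=> rrs; rewrite eq_sym (negPf rr') /= IH.
Qed.

Lemma eq_words rs w w' y : {in rs, w =1 w'} -> words rs w y = words rs w' y.
Proof.
elim: rs => //= r rs IH ww'; rewrite ww' ?mem_head // IH // => x xrs.
by apply: ww'; rewrite inE xrs orbT.
Qed.

(** The two input stacks come first, hence act last, as in [start_ineq]. *)
Definition all_regs := [:: r0, r1 & other_regs r0 r1].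

Lemma mem_all_regs r : r \in all_regs.
Proof.
by rewrite !in_cons mem_filter mem_enum !inE andbT orbA orbN.
Qed.

Lemma uniq_all_regs : uniq all_regs.
Proof.
rewrite /= in_cons negb_or r01 !mem_filter !inE !eqxx !orbT /=.
by rewrite filter_uniq ?enum_uniq.
Qed.

Definition conf_elt (c : conf Q R) := words all_regs c.1 (st c.2).

Lemma conf_elt_pull r (c : conf Q R) :
  conf_elt c = words (rem r all_regs) c.1 (word r (c.1 r) (st c.2)).
Proof.
by apply: words_pull; [exact: uniq_all_regs|exact: mem_all_regs|exact: state_rels].
Qed.

Lemma words_set_stack r (w : stacks R) s y :
  words (rem r all_regs) (set_stack w r s) y = words (rem r all_regs) w y.
Proof.
apply: eq_words => r'; rewrite mem_rem_uniq ?uniq_all_regs // inE ffunE.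
by move=> /andP[/negPf ->].
Qed.

(** With the affected stack next to the state, the inequality of the
    instruction lies under a monotone function that does not see the change. *)
Lemma conf_elt_step c c' : mstep delta c = Some c' -> conf_elt c <= conf_elt c'.
Proof.
case: c => w q /=; have := instr_rels q; rewrite /instr_ineqs.
case: (delta q) => [r q'|r q1 q2|] //=.
  rewrite andbT => h [<-]; rewrite (conf_elt_pull r) (conf_elt_pull r (_, q')) /=.
  rewrite words_set_stack ffunE eqxx word_cons.
  by apply: words_mono; exact: word_mono.
move=> /and3P[h1 h0 _]; case wr : (w r) => [|[] s] // [<-].
  rewrite (conf_elt_pull r) (conf_elt_pull r (_, q1)) /= words_set_stack ffunE.
  by rewrite eqxx wr word_cons; apply: words_mono; exact: word_mono.
rewrite (conf_elt_pull r) (conf_elt_pull r (_, q2)) /= wr !word_cons.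
by apply: words_mono; exact: word_mono.
Qed.

Lemma conf_elt_halts c : halts delta c -> conf_elt c <= bot.
Proof.
move=> [w [q [r hq]]]; apply: (@reach_elim _ _ (fun c => conf_elt c <= bot) _ _ _ _ r).
  have /= := instr_rels q; rewrite /instr_ineqs hq /= andbT => qbot.
  have /andP[_ /andP[_ /andP[_ /andP[_ /andP[_ /and5P[_ _ hd he _]]]]]] := frame_rels.
  have act_bot l y : y <= bot -> act (lt l) y <= bot.
    move=> ybot; have [_ lbot] := letter_rels l.
    apply: le_trans he; apply: rel_image_mono => //; apply: le_trans hd.
    by apply: rel_image_mono => //; apply: le_trans lbot; exact: rel_image_mono.
  have word_bot r' s y : y <= bot -> word r' s y <= bot.
    by elim: s y => //= b s IH y ybot; apply: IH; exact: act_bot.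
  by rewrite /conf_elt; elim: all_regs => //= r' rs; exact: word_bot.
by move=> c1 c2 /conf_elt_step; exact: le_trans.
Qed.

(** From [c0 <= bot] the spreading relation gives [B <= bot], the ways back
    give the same for [C] and [A], and all generators are below the join of
    these three. *)
Theorem halting_collapse n m :
  (start_ineq (@Order.meet d L) (@Order.join d L) fx n m).1 <=
    (start_ineq (@Order.meet d L) (@Order.join d L) fx n m).2 ->
  halts delta (unary (fun r => if r == r0 then n else if r == r1 then m else 0), q0) ->
  forall x, x \in gen_values fx lt st -> x = bot.
Proof.
move=> start /conf_elt_halts; rewrite /conf_elt /= !ffunE eqxx.
rewrite [r1 == r0]eq_sym (negPf r01) eqxx.
set w := unary _; have word_unary r k y : word r (rcons (nseq k true) false) y =
    act (lt (r, false)) (iter k (act (lt (r, true))) y).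
  rewrite /word -cats1 foldl_cat /=; congr (act _ _).
  by elim: k y => // k IH y; rewrite iterSr -IH.
rewrite !word_unary => c0bot.
have /and5P[base01 s0 z0 s1 /andP[z1 _]] := alias_rels.
have c0_le : act (fx 10) (iter n (act (fx 9)) (act (fx 12)
    (iter m (act (fx 11)) (g_base fx)))) <= bot.
  apply: le_trans c0bot.
  have iter_le k (l l' y y' : L) : l <= l' -> y <= y' ->
      iter k (act l) y <= iter k (act l') y'.
    by move=> ll yy; elim: k => [|k IH] //=; exact: act_mono.
  apply: act_mono => //; apply: (iter_le) => //; apply: act_mono => //.
  apply: (iter_le) => //; apply: le_trans base01 _.
  rewrite /other_regs /words; elim: (enum R) => //= r rs IH; case: ifP => //=.
  rewrite !inE negb_or => /andP[/negPf e0 /negPf e1].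
  by rewrite ffunE e0 e1; exact: act_mono.
have /andP[_ /andP[_ /andP[_ /andP[_ /andP[_ /and5P[CB AC hd he /andP[hr _]]]]]]] := frame_rels.
have Bbot : B <= bot.
  apply: le_trans hr; rewrite lexI lexx andbT; apply: le_trans start _.
  exact: leU2.
have Cbot : C <= bot.
  by apply: le_trans hd; rewrite lexI lexx andbT; apply: le_trans CB _; exact: leU2.
have Abot : A <= bot.
  by apply: le_trans he; rewrite lexI lexx andbT; apply: le_trans AC _; exact: leU2.
move=> x xg; apply/le_anti; rewrite gens_bot // andbT.
by apply: le_trans (gens_top xg) _; rewrite !leUx Abot Bbot.
Qed.
End Derivation.

(** * Finitely generated sublattices of subspace lattices *)

Definition in_sublattice (d : Order.disp_t) (L : latticeType d) (n : nat)
    (g : 'I_n -> L) (x : L) : Prop :=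
  forall S : set L, (forall i, S (g i)) ->
    (forall x y, S x -> S y -> S (x `&` y)%O /\ S (x `|` y)%O) -> S x.

Record sublattice (d : Order.disp_t) (L : latticeType d) (n : nat)
    (g : 'I_n -> L) := Sublattice {
  sublattice_val : L;
  _ : `[< in_sublattice g sublattice_val >]
}.

HB.instance Definition _ d (L : latticeType d) n (g : 'I_n -> L) :=
  [isSub for @sublattice_val d L n g].
HB.instance Definition _ d (L : latticeType d) n (g : 'I_n -> L) :=
  [Choice of sublattice g by <:].
HB.instance Definition _ d (L : latticeType d) n (g : 'I_n -> L) :=
  [SubChoice_isSubPOrder of sublattice g by <: with d].

Section Sublattice.
Local Open Scope ring_scope.
Local Open Scope classical_set_scope.
Context (d : Order.disp_t) (L : latticeType d) (n : nat) (g : 'I_n -> L).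
Implicit Types x y z : sublattice g.

Lemma sublatticeP x : in_sublattice g (val x).
Proof. by case: x => x /= /asboolP. Qed.

Lemma in_sublatticeI (x y : L) : in_sublattice g x -> in_sublattice g y ->
  in_sublattice g (x `&` y)%O.
Proof. by move=> gx gy S gS cS; apply: (cS _ _ (gx S gS cS) (gy S gS cS)).1. Qed.

Lemma in_sublatticeU (x y : L) : in_sublattice g x -> in_sublattice g y ->
  in_sublattice g (x `|` y)%O.
Proof. by move=> gx gy S gS cS; apply: (cS _ _ (gx S gS cS) (gy S gS cS)).2. Qed.

Definition sublattice_meet x y : sublattice g :=
  Sublattice (introT (asboolP _) (in_sublatticeI (sublatticeP x) (sublatticeP y))).
Definition sublattice_join x y : sublattice g :=
  Sublattice (introT (asboolP _) (in_sublatticeU (sublatticeP x) (sublatticeP y))).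

Lemma sublattice_meetP x y z :
  (x <= sublattice_meet y z)%O = (x <= y)%O && (x <= z)%O.
Proof. by rewrite !leEsub lexI. Qed.

Lemma sublattice_joinP x y z :
  (sublattice_join x y <= z)%O = (x <= z)%O && (y <= z)%O.
Proof. by rewrite !leEsub leUx. Qed.
End Sublattice.

HB.instance Definition _ d (L : latticeType d) n (g : 'I_n -> L) :=
  Order.POrder_MeetJoin_isLattice.Build d (sublattice g)
    (@sublattice_meetP d L n g) (@sublattice_joinP d L n g).

Section SublatticeTheory.
Local Open Scope ring_scope.
Local Open Scope classical_set_scope.
Context (d : Order.disp_t) (L : latticeType d) (n : nat) (g : 'I_n -> L).

Lemma in_sublattice_gen i : in_sublattice g (g i).
Proof. by move=> S. Qed.

Definition sublattice_gen i : sublattice g :=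
  Sublattice (introT (asboolP _) (in_sublattice_gen i)).

Lemma sublattice_gen_generates : generates sublattice_gen.
Proof.
move=> S Sg Sc x.
pose S' (u : L) := exists2 y : sublattice g, S y & val y = u.
suff [y Sy /val_inj <-] : S' (val x) by [].
apply: (sublatticeP x) => [i|u v [y Sy <-] [z Sz <-]].
  by exists (sublattice_gen i).
by have [? ?] := Sc _ _ Sy Sz; split; [exists (y `&` z)%O|exists (y `|` z)%O].
Qed.

Lemma sublattice_eval t :
  val (lterm_eval sublattice_gen t) = lterm_eval g t.
Proof. by elim: t => //= s IHs t IHt; rewrite -IHs -IHt. Qed.

Lemma sublattice_admits rels : satisfies g rels ->
  admits (sublattice g) (Presentation rels).
Proof.
move=> sat; exists sublattice_gen; split; first exact: sublattice_gen_generates.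
elim: rels sat => //= -[s t] rels IH /= [st /IH sat]; split => //.
by apply: val_inj; rewrite !sublattice_eval.
Qed.

Lemma in_sublattice_eval t : in_sublattice g (lterm_eval g t).
Proof.
elim: t => [i|s IHs t IHt|s IHs t IHt] /=.
- exact: in_sublattice_gen.
- exact: in_sublatticeI.
- exact: in_sublatticeU.
Qed.
End SublatticeTheory.

Section SubspaceImage.
Local Open Scope ring_scope.
Local Open Scope classical_set_scope.
Context (F : fieldType) (W V : lmodType F) (phi : {linear W -> V}).
Hypothesis phi_inj : injective phi.

Lemma submod_closed_image (U : subspace W) :
  `[< GRing.submod_closed [in phi @` subspace_set U] >].
Proof.
have [U0 UL] := subspaceP U; apply/asboolP; split.
  by rewrite inE; exists 0; rewrite ?linear0.
move=> a x y; rewrite !inE => -[u Uu <-] [w Uw <-].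
by exists (a *: u + w); rewrite ?linearP //; exact: UL.
Qed.

Definition subspace_image U : subspace V := Subspace (submod_closed_image U).

Lemma subspace_eqP (X : lmodType F) (U U' : subspace X) :
  (forall x, subspace_set U x <-> subspace_set U' x) -> U = U'.
Proof. by move=> UU'; apply: val_inj; apply/seteqP; split=> x /UU'. Qed.

Lemma subspace_image_inj : injective subspace_image.
Proof.
move=> U U' /(congr1 (@subspace_set F V)) /= e.
have sub (U1 U2 : subspace W) : phi @` subspace_set U1 = phi @` subspace_set U2 ->
    forall x, subspace_set U1 x -> subspace_set U2 x.
  move=> e12 x U1x; have : (phi @` subspace_set U1) (phi x) by exists x.
  by rewrite e12 => -[y U2y /phi_inj <-].
by apply: subspace_eqP => x; split; apply: sub.
Qed.

(** Injectivity of [phi] is essential for meets. *)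
Lemma subspace_imageI U U' :
  subspace_image (U `&` U')%O = (subspace_image U `&` subspace_image U')%O.
Proof.
apply: subspace_eqP => x; split=> [[w [Uw U'w] <-]|[[w Uw <-] [w' U'w /phi_inj e]]].
  by split; exists w.
by exists w => //; split => //; rewrite -e.
Qed.

Lemma subspace_imageU U U' :
  subspace_image (U `|` U')%O = (subspace_image U `|` subspace_image U')%O.
Proof.
apply: subspace_eqP => x; split.
  by move=> [_ [u Uu [u' U'u <-]] <-]; exists (phi u); [exists u|
    exists (phi u'); [exists u'|rewrite linearD]].
move=> [_ [u Uu <-] [_ [u' U'u <-] <-]]; exists (u + u'); last by rewrite linearD.
by exists u => //; exists u'.
Qed.
End SubspaceImage.

Section SublatticeImage.
Local Open Scope ring_scope.
Local Open Scope classical_set_scope.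
Context (F : fieldType) (W V : lmodType F) (phi : {linear W -> V}).
Hypothesis phi_inj : injective phi.
Context (n : nat) (g : 'I_n -> subspace W).

Definition sublattice_image (x : sublattice g) : subspace V :=
  subspace_image phi (val x).

Lemma sublattice_image_inj : injective sublattice_image.
Proof. by move=> x y /(subspace_image_inj phi_inj) /val_inj. Qed.

Lemma sublattice_imageI : {morph sublattice_image : x y / (x `&` y)%O}.
Proof. by move=> x y; exact: (subspace_imageI phi_inj). Qed.

Lemma sublattice_imageU : {morph sublattice_image : x y / (x `|` y)%O}.
Proof. by move=> x y; exact: subspace_imageU. Qed.

Lemma sublattice_image_le : {homo sublattice_image : x y / (x <= y)%O}.
Proof.
by move=> x y; rewrite !leEmeet => /eqP xy; rewrite -sublattice_imageI xy.
Qed.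

Lemma sublattice_image_lmorphism :
  exists f : {lmorphism (sublattice g) -> subspace V}, f = sublattice_image :> (_ -> _).
Proof.
pose m0 := Order.isOrderMorphism.Build _ _ _ _ sublattice_image sublattice_image_le.
pose m1 := Order.isMeetLatticeMorphism.Build _ _ _ _ sublattice_image sublattice_imageI.
pose m2 := Order.isJoinLatticeMorphism.Build _ _ _ _ sublattice_image sublattice_imageU.
pose f : {lmorphism (sublattice g) -> subspace V} :=
  HB.pack sublattice_image m0 m1 m2.
by exists f.
Qed.
End SublatticeImage.

Lemma card_le_I_inj (T : Type) N (x : nat -> T) :
  injective x -> ~ ([set: T] #<= `I_N)%card.
Proof.
move=> xinj /pcard_leP[h].
have hx k : (h (x k) < N)%N by have := @funS _ _ _ _ h (x k) I.
pose f (i : 'I_N.+1) : 'I_N := Ordinal (hx i).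
have : injective f.
  move=> i j /(congr1 val) /= e; apply: val_inj; apply: xinj.
  by move: e; apply: (@inj _ _ _ h); rewrite inE.
by move/leq_card; rewrite !card_ord ltnn.
Qed.

(** The generated sublattice of [L(W)] embeds in [L(V)], hence belongs to the
    class, and it contains all the [x k]. *)
Theorem infinite_not_bounded (A : lattice_class)
  (A_closed : closed_under_fg_sublattices A)
  (F : fieldType) (W V : lmodType F) (phi : {linear W -> V})
  (A_LV : A _ (subspace V : latticeType _))
  n (g : 'I_n -> subspace W) rels (x : nat -> subspace W) :
  injective phi -> satisfies g rels -> injective x ->
  (forall k, in_sublattice g (x k)) ->
  ~ finitely_bounded A (Presentation rels).
Proof.
move=> phi_inj sat xinj gx [N bound].
have [f fE] := sublattice_image_lmorphism phi_inj g.
have AM : A _ (sublattice g : latticeType _).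
  apply: (A_closed _ _ _ _ f A_LV).
    by rewrite fE; exact: sublattice_image_inj.
  by exists n, (sublattice_gen g); exact: sublattice_gen_generates.
have := bound _ _ AM (sublattice_admits sat).
apply: (@card_le_I_inj _ N (fun k => Sublattice (introT (asboolP _) (gx k)))).
by move=> i j /(congr1 val) /= /xinj.
Qed.

(** * Linear maps attached to a stack machine *)

(** Polynomials serve as the free vector space on the natural numbers, with the
    monomials as its basis. *)
Section LinearExtension.
Local Open Scope ring_scope.
Context (F : fieldType) (V : lmodType F) (tau : nat -> V).

Definition poly_lext (p : {poly F}) : V := \sum_(i < size p) p`_i *: tau i.

Lemma lext_widen n (p : {poly F}) : (size p <= n)%N ->
  poly_lext p = \sum_(i < n) p`_i *: tau i.
Proof.
move=> le_n; rewrite /poly_lext (big_ord_widen n (fun i => p`_i *: tau i)) //.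
rewrite big_mkcond; apply: eq_bigr => i _; case: ltnP => // le_p.
by rewrite nth_default ?scale0r.
Qed.

Lemma lext_is_linear : linear poly_lext.
Proof.
move=> a p q; pose n := maxn (size (a *: p + q)) (maxn (size p) (size q)).
rewrite !(@lext_widen n) ?leq_max ?leqnn ?orbT // scaler_sumr -big_split /=.
by apply: eq_bigr => i _; rewrite coefD coefZ scalerDl scalerA.
Qed.

HB.instance Definition _ :=
  GRing.isLinear.Build F {poly F} V *:%R poly_lext lext_is_linear.

Lemma poly_lextX i : poly_lext 'X^i = tau i.
Proof.
rewrite /poly_lext size_polyXn big_ord_recr /= coefXn eqxx scale1r big1 ?add0r //.
by move=> j _; rewrite coefXn ltn_eqF ?scale0r.
Qed.

Lemma linear_polyP (f g : {linear {poly F} -> V}) :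
  (forall i, f 'X^i = g 'X^i) -> f =1 g.
Proof.
move=> fg p; rewrite -[p]coefK poly_def !linear_sum.
by apply: eq_bigr => i _; rewrite !linearZ /= fg.
Qed.
End LinearExtension.

Section Machine.
Local Open Scope ring_scope.
Variables (Q R : finType) (delta : Q -> instr Q R).
Local Notation conf := (conf Q R).
Local Notation step := (mstep delta).

(** The letter that acts last is at the bottom of its stack. *)
Definition push_bottom (l : R * bool) (c : conf) : conf :=
  (set_stack c.1 l.1 (rcons (c.1 l.1) l.2), c.2).

Lemma push_bottomC l l' c : l.1 != l'.1 ->
  push_bottom l (push_bottom l' c) = push_bottom l' (push_bottom l c).
Proof.
move=> ll; congr (_, _); apply/ffunP => r; rewrite !ffunE /=.
case: (r =P l.1) => [->|_]; first by rewrite (negPf ll).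
by case: (r =P l'.1) => // _; rewrite eq_sym (negPf ll).
Qed.

(** The machine looks only at the tops of the stacks and is blocked by an empty
    stack, so its steps survive when letters are added at the bottom. *)
Lemma push_bottom_step l c c' : step c = Some c' ->
  step (push_bottom l c) = Some (push_bottom l c').
Proof.
case: c c' => w q [w' q'] /=; case: (delta q) => [r p|r p1 p0|] //.
  move=> [<- <-]; congr (Some (_, _)); apply/ffunP => i; rewrite !ffunE /=.
  case: (r =P l.1) => [->|/eqP rl]; first by rewrite eqxx; case: (i =P l.1).
  rewrite [l.1 == r]eq_sym (negPf rl).
  by case: (i =P r) => [->|_]; rewrite ?(negPf rl).
rewrite ffunE; case: (eqVneq r l.1) => [->|rl].
  case wl : (w l.1) => [|[] s] //= [<- <-]; congr (Some (_, _)).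
    by apply/ffunP => i; rewrite !ffunE eqxx; case: eqP.
  by rewrite wl.
case wr : (w r) => [|[] s] //= [<- <-]; congr (Some (_, _)).
apply/ffunP => i; rewrite !ffunE [l.1 == r]eq_sym (negPf rl).
by case: (i =P r) => [->|_]; rewrite ?(negPf rl).
Qed.

Lemma push_bottom_reach l c c' : reach step c c' ->
  reach step (push_bottom l c) (push_bottom l c').
Proof.
apply: (@reach_elim _ _
  (fun c => reach step (push_bottom l c) (push_bottom l c'))) => [|c1 c2 c12 r2].
  exact: reach_refl.
by apply: reach_trans r2; apply: reach_step; exact: push_bottom_step.
Qed.

(** The equivalence relation generated by the steps: as the machine is
    deterministic, equivalent configurations have a common descendant. *)
Definition joinable (c c' : conf) : Prop :=
  exists2 e, reach step c e & reach step c' e.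

Lemma joinable_refl c : joinable c c.
Proof. by exists c; exact: reach_refl. Qed.

Lemma joinable_sym c c' : joinable c c' -> joinable c' c.
Proof. by case=> e ce c'e; exists e. Qed.

Lemma joinable_trans c1 c2 c3 :
  joinable c1 c2 -> joinable c2 c3 -> joinable c1 c3.
Proof.
move=> [e c1e c2e] [e' c2e' c3e'].
have [ee'|e'e] := reach_linear c2e c2e'.
  by exists e' => //; exact: reach_trans c1e ee'.
by exists e => //; exact: reach_trans c3e' e'e.
Qed.

Lemma joinable_push l c c' : joinable c c' ->
  joinable (push_bottom l c) (push_bottom l c').
Proof. by case=> e ce c'e; exists (push_bottom l e); exact: push_bottom_reach. Qed.

Lemma joinable_halts c c' : joinable c c' -> halts delta c -> halts delta c'.
Proof.
move=> [e ce c'e] [w [q [r hq]]].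
have stuck : step (w, q) = None by rewrite /= hq.
exists w, q; split=> //.
have [we|ew] := reach_linear r ce; last exact: reach_trans c'e ew.
by rewrite -(reach_stuck stuck we).
Qed.

Lemma halts_push l c : halts delta c -> halts delta (push_bottom l c).
Proof.
move=> [w [q [r hq]]]; exists (push_bottom l (w, q)).1, q; split=> //.
exact: push_bottom_reach r.
Qed.

(** A representative instead of a quotient: the vectors are then indexed by
    plain configurations, which are countable. *)
Definition class_rep (c : conf) : conf := choose (fun c' => `[< joinable c c' >]) c.

Lemma rep_joinable c : joinable c (class_rep c).
Proof.
apply/asboolP/(@chooseP _ (fun c' => `[< joinable c c' >])).
by apply/asboolP; exact: joinable_refl.
Qed.

Lemma eq_rep c c' : joinable c c' -> class_rep c = class_rep c'.
Proof.
move=> cc'; rewrite /class_rep.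
have -> : (fun x => `[< joinable c' x >]) = (fun x => `[< joinable c x >]).
  apply: funext => x; apply: asbool_equiv_eq.
  by split; apply: joinable_trans; [|exact: joinable_sym].
by apply: choose_id; apply/asboolP; [exact: joinable_refl|].
Qed.

Section Vectors.
Local Open Scope ring_scope.
Variable F : fieldType.
Local Notation P := {poly F}.

(** For each [u], one vector for each class of configurations, and [0] for the
    classes that lead to a halting state. *)
Definition conf_vec (c : conf) (u : nat) : P :=
  if `[< halts delta c >] then 0 else 'X^(pickle (class_rep c, u)).

Lemma eq_conf_vec c c' u : joinable c c' -> conf_vec c u = conf_vec c' u.
Proof.
move=> cc'; rewrite /conf_vec (eq_rep cc').
suff -> : `[< halts delta c >] = `[< halts delta c' >] by [].
by apply: asbool_equiv_eq; split; apply: joinable_halts; [|exact: joinable_sym].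
Qed.

(** Basis vectors are numbered by [pickle]; the numbers that are not in its
    image are sent to [0]. *)
Definition letter_map l : {linear P -> P} :=
  poly_lext (fun k => if unpickle k is Some (c, u) then conf_vec (push_bottom l c) u
                 else 0).

(** The definition of [letter_map] concerns representatives; it extends to
    all configurations because adding a bottom letter preserves both joinability
    and halting. *)
Lemma letter_vec l c u : letter_map l (conf_vec c u) = conf_vec (push_bottom l c) u.
Proof.
rewrite {1}/conf_vec; case: asboolP => [hc|_].
  by rewrite linear0 /conf_vec asboolT //; exact: halts_push.
rewrite [LHS]poly_lextX pickleK; apply: eq_conf_vec; apply: joinable_push.
exact/joinable_sym/rep_joinable.
Qed.

(** The image of this map is the subspace attached to [c].  It has infinite
    dimension unless [c] halts, thanks to the index [u]. *)
Definition conf_map c : {linear P -> P} := poly_lext (conf_vec c).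

Lemma conf_mapX c u : conf_map c 'X^u = conf_vec c u.
Proof. exact: poly_lextX. Qed.

Lemma letter_conf l c : letter_map l \o conf_map c =1 conf_map (push_bottom l c).
Proof.
apply: linear_polyP => u.
by rewrite [LHS]/= !conf_mapX letter_vec.
Qed.

Lemma eq_conf_map c c' : joinable c c' -> conf_map c =1 conf_map c'.
Proof.
by move=> cc'; apply: linear_polyP => u; rewrite !conf_mapX (eq_conf_vec _ cc').
Qed.

Lemma letter_mapC l l' : l.1 != l'.1 ->
  letter_map l \o letter_map l' =1 letter_map l' \o letter_map l.
Proof.
move=> ll; apply: linear_polyP => k; rewrite /= [letter_map l' 'X^k]poly_lextX.
rewrite [letter_map l 'X^k]poly_lextX.
case: (unpickle k) => [[c u]|]; last by rewrite !linear0.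
by rewrite !letter_vec push_bottomC.
Qed.

(** A left inverse of [conf_map c] if [c] does not halt. *)
Definition spread_map c : {linear P -> P} :=
  poly_lext (fun k => if unpickle k is Some (c', u) then
                   if c' == class_rep c then 'X^u else 0 else 0).

Lemma spread_conf c : ~ halts delta c -> spread_map c \o conf_map c =1 idfun.
Proof.
move=> hc; apply: linear_polyP => u; rewrite /= conf_mapX /conf_vec asboolF //.
by rewrite [LHS]poly_lextX pickleK eqxx.
Qed.
End Vectors.
End Machine.
Arguments conf_map : simpl never.
Arguments letter_map : simpl never.
Arguments spread_map : simpl never.

(** * Linear relations on three copies of a polynomial space *)

Section TriplePolynomials.
Local Open Scope ring_scope.
Variable F : fieldType.
Local Notation P := {poly F}.
Definition triple_poly : lmodType F := (P * P * P)%type.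
Local Notation W := triple_poly.
Implicit Types f g h : {linear P -> P}.

(** All generators of the model are images of linear maps into [P * P * P]
    given by three components. *)
Definition triple_set f g h : set W := [set x | exists p, x = (f p, g p, h p)]%classic.

Lemma triple_closed f g h : `[< GRing.submod_closed [in triple_set f g h] >].
Proof.
apply/asboolP; split; first by rewrite inE; exists 0; rewrite !linear0.
move=> a u v; rewrite !inE => -[p ->] [q ->].
by exists (a *: p + q); rewrite !linearP.
Qed.

Definition triple_image f g h : subspace W := Subspace (triple_closed f g h).

Lemma triple_leP f g h (U : subspace W) :
  (forall p, subspace_set U (f p, g p, h p)) -> (triple_image f g h <= U)%O.
Proof. by move=> sub; apply/subspace_leP => _ [p ->]. Qed.

Lemma eq_triple f g h f' g' h' : f =1 f' -> g =1 g' -> h =1 h' ->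
  triple_image f g h = triple_image f' g' h'.
Proof.
by move=> ff gg hh; apply: subspace_eqP => x; split=> -[p ->]; exists p;
  rewrite ff gg hh.
Qed.

Lemma mem_join (U U' : subspace W) x y : subspace_set U x -> subspace_set U' y ->
  subspace_set (U `|` U')%O (x + y).
Proof. by exists x => //; exists y. Qed.

Lemma tripleE (a b c a' b' c' : P) :
  ((a, b, c) : W) + (a', b', c') = (a + a', b + b', c + c').
Proof. by []. Qed.

Definition zero_map : {linear P -> P} := \0.
Definition id_map : {linear P -> P} := idfun.
Definition opp_map f : {linear P -> P} := (\- f).

Lemma zero_mapE p : zero_map p = 0. Proof. by []. Qed.
Lemma id_mapE p : id_map p = p. Proof. by []. Qed.
Lemma opp_mapE f p : opp_map f p = - f p. Proof. by []. Qed.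
Definition mapsE := (zero_mapE, id_mapE, opp_mapE).

Lemma triple_inj (a b c a' b' c' : P) :
  ((a, b, c) : W) = (a', b', c') -> [/\ a = a', b = b' & c = c'].
Proof. by case=> -> -> ->. Qed.

Definition bot_sp := triple_image zero_map zero_map zero_map.
Definition A_sp := triple_image id_map zero_map zero_map.
Definition B_sp := triple_image zero_map id_map zero_map.
Definition C_sp := triple_image zero_map zero_map id_map.
(** Graphs are taken with a sign, so that the image of [y] under the graph of
    [f] is the image under [f] and not under [- f]. *)
Definition d_sp := triple_image zero_map id_map (opp_map id_map).
Definition e_sp := triple_image (opp_map id_map) zero_map id_map.
Definition graph_sp f := triple_image id_map (opp_map f) zero_map.
Definition line_sp f := triple_image f zero_map zero_map.

Local Notation mt := (@Order.meet _ (subspace W)).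
Local Notation jn := (@Order.join _ (subspace W)).

Lemma eq_graph_sp f f' : f =1 f' -> graph_sp f = graph_sp f'.
Proof. by move=> ff'; apply: eq_triple => // p; rewrite !mapsE ff'. Qed.

Lemma eq_line_sp f f' : f =1 f' -> line_sp f = line_sp f'.
Proof. by move=> ff'; apply: eq_triple. Qed.

Lemma rel_image_graph f g : rel_image mt jn (line_sp g) (graph_sp f) B_sp =
  triple_image zero_map (f \o g) zero_map.
Proof.
apply: subspace_eqP => x; split.
  move=> [[_ [p ->] [_ [q ->] <-]] [b]].
  rewrite tripleE !mapsE !add0r => /triple_inj[/eqP + _ _].
  rewrite addr_eq0 => /eqP gp; exists p.
  by rewrite !mapsE /= gp linearN addNr.
move=> [p ->]; split; last by exists (f (g p)).
exists (g p, 0, 0); first by exists p.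
exists (- g p, - f (- g p), 0); first by exists (- g p).
by rewrite tripleE subrr addr0 add0r linearN opprK.
Qed.

Lemma rel_image_d g : rel_image mt jn (triple_image zero_map g zero_map) d_sp C_sp =
  triple_image zero_map zero_map g.
Proof.
apply: subspace_eqP => x; split.
  move=> [[_ [p ->] [_ [q ->] <-]] [b]].
  rewrite tripleE !mapsE !add0r => /triple_inj[_ /eqP + _].
  rewrite addr_eq0 => /eqP gp; exists p.
  by rewrite !mapsE /= gp addNr.
move=> [p ->]; split; last by exists (g p).
exists (0, g p, 0); first by exists p.
exists (0, - g p, - - g p); first by exists (- g p).
by rewrite tripleE subrr addr0 add0r opprK.
Qed.

Lemma rel_image_e g : rel_image mt jn (triple_image zero_map zero_map g) e_sp A_sp =
  line_sp g.
Proof.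
apply: subspace_eqP => x; split.
  move=> [[_ [p ->] [_ [q ->] <-]] [b]].
  rewrite tripleE !mapsE !add0r => /triple_inj[_ _ /eqP].
  rewrite addr_eq0 => /eqP gp; exists p.
  by rewrite !mapsE /= gp addNr.
move=> [p ->]; split; last by exists (g p).
exists (0, 0, g p); first by exists p.
exists (- - g p, 0, - g p); first by exists (- g p).
by rewrite tripleE subrr addr0 add0r opprK.
Qed.

Lemma through_C f : mt (jn (graph_sp f) d_sp) (jn A_sp C_sp) =
  triple_image id_map zero_map (opp_map f).
Proof.
apply: subspace_eqP => x; split.
  move=> [[_ [p ->] [_ [q ->] <-]] [_ [p' ->] [_ [q' ->]]]].
  rewrite !tripleE !mapsE !(add0r, addr0) => /triple_inj[_ /esym/eqP + _].
  rewrite addrC subr_eq0 => /eqP ->; exists p.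
  by rewrite !mapsE subrr.
move=> [p ->]; split.
  exists (p, - f p, 0); first by exists p.
  exists (0, f p, - f p); first by exists (f p).
  by rewrite tripleE !mapsE !(add0r, addr0) addNr.
exists (p, 0, 0); first by exists p.
exists (0, 0, - f p); first by exists (- f p).
by rewrite tripleE !mapsE !(add0r, addr0).
Qed.

Lemma from_C f : mt (jn e_sp (graph_sp f)) (jn C_sp B_sp) =
  triple_image zero_map (opp_map f) id_map.
Proof.
apply: subspace_eqP => x; split.
  move=> [[_ [p ->] [_ [q ->] <-]] [_ [p' ->] [_ [q' ->]]]].
  rewrite !tripleE !mapsE !(add0r, addr0) => /triple_inj[/esym/eqP + _ _].
  rewrite addrC subr_eq0 => /eqP ->; exists p.
  by rewrite !mapsE subrr.
move=> [p ->]; split.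
  exists (- p, 0, p); first by exists p.
  exists (p, - f p, 0); first by exists p.
  by rewrite tripleE !mapsE !(add0r, addr0) addNr.
exists (0, 0, p); first by exists p.
exists (0, - f p, 0); first by exists (- f p).
by rewrite tripleE !mapsE !(add0r, addr0).
Qed.

Lemma two_graph f g :
  mt (jn (triple_image id_map zero_map (opp_map f))
         (triple_image zero_map (opp_map g) id_map)) (jn A_sp B_sp) =
  graph_sp (g \o f).
Proof.
apply: subspace_eqP => x; split.
  move=> [[_ [p ->] [_ [q ->] <-]] [_ [p' ->] [_ [q' ->]]]].
  rewrite !tripleE !mapsE !(add0r, addr0) => /triple_inj[_ _ /esym/eqP].
  rewrite addrC subr_eq0 => /eqP ->; exists p.
  by rewrite !mapsE subrr.
move=> [p ->]; split.
  exists (p, 0, - f p); first by exists p.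
  exists (0, - g (f p), f p); first by exists (f p).
  by rewrite tripleE !mapsE !(add0r, addr0) addNr.
exists (p, 0, 0); first by exists p.
exists (0, - g (f p), 0); first by exists (- g (f p)).
by rewrite tripleE !mapsE !(add0r, addr0).
Qed.

Section Values.
Local Open Scope ring_scope.
Variables (fx : nat -> subspace W).
Hypothesis fxA : fx 1 = A_sp.
Hypothesis fxB : fx 2 = B_sp.
Hypothesis fxC : fx 3 = C_sp.
Hypothesis fxd : fx 4 = d_sp.
Hypothesis fxe : fx 5 = e_sp.

Lemma act_graph f g :
  letter_act mt jn fx (graph_sp f) (line_sp g) = line_sp (f \o g).
Proof.
by rewrite /letter_act /g_A /g_B /g_C /g_d /g_e fxA fxB fxC fxd fxe
  rel_image_graph rel_image_d rel_image_e.
Qed.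

Lemma two_graphs f g : two_letters mt jn fx (graph_sp f) (graph_sp g) =
  graph_sp (g \o f).
Proof.
by rewrite /two_letters /g_A /g_B /g_C /g_d /g_e fxA fxB fxC fxd fxe
  through_C from_C two_graph.
Qed.
End Values.
End TriplePolynomials.
Arguments triple_image : simpl never.
Arguments graph_sp : simpl never.
Arguments line_sp : simpl never.

(** * A subspace model of a machine that does not halt *)

Section Model.
Local Open Scope ring_scope.
Variables (F : fieldType) (Q R : finType) (delta : Q -> instr Q R).
Variables (r0 r1 : R) (q0 : Q) (n m : nat).
Hypothesis r01 : r0 != r1.
Local Notation P := {poly F}.
Local Notation W := (triple_poly F).

Let c0 : conf Q R :=
  (unary (fun r => if r == r0 then n else if r == r1 then m else 0%N), q0).
Hypothesis c0_runs : ~ halts delta c0.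

Definition shift_map k : {linear P -> P} := poly_lext (fun i => 'X^(i + k)).

Arguments shift_map : simpl never.

Definition conf_sp c : subspace W := line_sp (conf_map delta F c).

Definition letter_sp l : subspace W := graph_sp (letter_map delta F l).

Definition state_sp q : subspace W := conf_sp ([ffun=> [::]], q).

Arguments conf_sp : simpl never.
Arguments letter_sp : simpl never.
Arguments state_sp : simpl never.

Definition base_conf : conf Q R :=
  ([ffun r => if r \in [:: r0; r1] then [::] else [:: false]], q0).

(** The interpretations of the fixed generators, in the order of their
    numbers. *)
Definition frame_sp (i : nat) : subspace W := nth (bot_sp F)
  [:: bot_sp F; A_sp F; B_sp F; C_sp F; d_sp F; e_sp F;
      graph_sp (spread_map delta F c0); graph_sp (shift_map 1);
      conf_sp base_conf;
      letter_sp (r0, true); letter_sp (r0, false);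
      letter_sp (r1, true); letter_sp (r1, false)] i.

Local Notation mt := (@Order.meet _ (subspace W)).
Local Notation jn := (@Order.join _ (subspace W)).
Local Notation act := (letter_act mt jn frame_sp).

Lemma act_conf l c : act (letter_sp l) (conf_sp c) = conf_sp (push_bottom l c).
Proof.
by rewrite /letter_sp /conf_sp act_graph // (eq_line_sp (letter_conf _ _ _)).
Qed.

Lemma act_state l q : act (letter_sp l) (state_sp q) =
  conf_sp (push_bottom l ([ffun=> [::]], q)).
Proof. exact: act_conf. Qed.

Lemma eq_conf_sp c c' : reach (mstep delta) c c' -> conf_sp c = conf_sp c'.
Proof.
move=> cc'; apply: eq_line_sp; apply: eq_conf_map.
by exists c' => //; exact: reach_refl.
Qed.

Lemma conf_sp_halt c : halts delta c -> conf_sp c = bot_sp F.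
Proof.
move=> hc; apply: eq_line_sp; apply: linear_polyP => u.
by rewrite conf_mapX /conf_vec asboolT.
Qed.

Lemma rel_image_bot_graph f : rel_image mt jn (bot_sp F) (graph_sp f) (B_sp F) = bot_sp F.
Proof.
rewrite -[in LHS]/(line_sp (zero_map F)) rel_image_graph; apply: eq_triple => // p /=.
by rewrite linear0.
Qed.

Lemma sub_top (U : subspace W) : (U <= A_sp F `|` B_sp F `|` C_sp F)%O.
Proof.
apply/subspace_leP => -[[a b] c] _.
have -> : (a, b, c) = ((a, 0, 0) : W) + (0, b, 0) + (0, 0, c).
  by rewrite !tripleE !(addr0, add0r).
do 2?apply: mem_join; by [exists a|exists b|exists c].
Qed.

Lemma bot_sub (U : subspace W) : (bot_sp F <= U)%O.
Proof. by have [U0 _] := subspaceP U; apply: triple_leP => p. Qed.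

Lemma graph_sub f : (graph_sp f <= A_sp F `|` B_sp F)%O.
Proof.
apply: triple_leP => p; rewrite !mapsE.
have -> : (p, - f p, 0) = ((p, 0, 0) : W) + (0, - f p, 0).
  by rewrite !tripleE !(addr0, add0r).
by apply: mem_join; [exists p|exists (- f p)].
Qed.

Lemma frame_holds : all (fun p => p.1 <= p.2)%O (frame_ineqs mt jn frame_sp).
Proof.
rewrite /frame_ineqs /= andbT.
apply/and5P; split; [| | | |apply/and5P; split; [| | | |apply/andP; split]].
- apply/subspace_leP => x [[_ [p ->] [_ [q ->] <-]] [_ [p' ->] [_ [q' ->]]]].
  rewrite !tripleE !mapsE !(add0r, addr0) => /triple_inj[<- _ _].
  by exists q.
- apply/subspace_leP => x [[_ [p ->] [_ [q ->] <-]] [_ [p' ->] [_ [q' ->]]]].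
  rewrite !tripleE !mapsE !(add0r, addr0) => /triple_inj[_ _ <-].
  by exists q.
- apply/subspace_leP => x [[_ [p ->] [_ [q ->] <-]] [_ [p' ->] [_ [q' ->]]]].
  rewrite !tripleE !mapsE !(add0r, addr0) => /triple_inj[<- _ _].
  by exists q.
- apply: triple_leP => p; exists (0, p, 0); first by exists p.
  by exists (0, 0, - p); [exists (- p)|rewrite tripleE !(addr0, add0r)].
- apply: triple_leP => p; exists (0, 0, p); first by exists p.
  by exists (- p, 0, 0); [exists (- p)|rewrite tripleE !(addr0, add0r)].
- apply: triple_leP => p; exists (0, p, 0); first by exists p.
  exists (0, - p, - - p); first by exists (- p).
  by rewrite tripleE !(addr0, add0r) subrr opprK.
- apply: triple_leP => p; exists (0, 0, p); first by exists p.
  exists (- - p, 0, - p); first by exists (- p).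
  by rewrite tripleE !(addr0, add0r) subrr opprK.
- by rewrite -[X in rel_image _ _ X]/(triple_image (zero_map F) (zero_map F) (zero_map F))
    rel_image_d.
- by rewrite -[X in rel_image _ _ X]/(triple_image (zero_map F) (zero_map F) (zero_map F))
    rel_image_e.
- by rewrite rel_image_bot_graph.
Qed.

(** The base contributes the bottom markers of the stacks that receive no
    input; those of the two input stacks are added after the inputs. *)
Lemma base_conf_sp : conf_sp base_conf =
  foldr (fun r => act (letter_sp (r, false))) (state_sp q0) (other_regs r0 r1).
Proof.
(* The markers are added one register at a time. *)
pose w (s : seq R) : conf Q R := ([ffun r => if r \in s then [:: false] else [::]], q0).
have wE s : uniq s -> conf_sp (w s) =
    foldr (fun r => act (letter_sp (r, false))) (state_sp q0) s.
  elim: s => [_|r s IH /= /andP[rs us]] /=.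
    by congr conf_sp; congr (_, _); apply/ffunP => r; rewrite !ffunE.
  rewrite -IH // act_conf; congr conf_sp; congr (_, _); apply/ffunP => i.
  by rewrite !ffunE inE; case: eqP => //= _; rewrite (negPf rs).
rewrite -wE; last by rewrite /other_regs filter_uniq ?enum_uniq.
congr conf_sp; congr (_, _).
apply/ffunP => r; rewrite !ffunE mem_filter mem_enum andbT.
by case: ifP.
Qed.

Lemma iter_act_conf k l w q : iter k (act (letter_sp l)) (conf_sp (w, q)) =
  conf_sp (set_stack w l.1 (w l.1 ++ nseq k l.2), q).
Proof.
elim: k => [|k IH] /=.
  congr conf_sp; congr (_, _); apply/ffunP => i; rewrite ffunE cats0.
  by case: eqP => // ->.
rewrite IH act_conf; congr conf_sp; congr (_, _); apply/ffunP => i; rewrite !ffunE /=.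
rewrite eqxx; case: eqP => // _; rewrite -cats1 -catA; congr (_ ++ _).
by elim: k {IH} => //= k ->.
Qed.

Lemma start_conf_sp : act (frame_sp 10) (iter n (act (frame_sp 9))
    (act (frame_sp 12) (iter m (act (frame_sp 11)) (frame_sp 8)))) = conf_sp c0.
Proof.
rewrite [frame_sp 8]/= iter_act_conf act_conf iter_act_conf act_conf.
congr conf_sp; congr (_, _); apply/ffunP => r; rewrite !ffunE /= !inE.
have r10 : (r1 == r0) = false by rewrite eq_sym (negPf r01).
case: (r =P r0) => [_|_].
  by rewrite !eqxx (negPf r01).
by case: (r =P r1) => [_|_]; rewrite ?eqxx ?r10 /= ?cats1.
Qed.

Lemma start_holds : ((start_ineq mt jn frame_sp n m).1 <=
                     (start_ineq mt jn frame_sp n m).2)%O.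
Proof.
rewrite /start_ineq start_conf_sp; apply: triple_leP => p; rewrite !mapsE.
have sp : spread_map delta F c0 (conf_map delta F c0 p) = p := spread_conf c0_runs p.
(* [spread_map] inverts [conf_map], so [p] is the image of its own vector. *)
exists (conf_map delta F c0 p, 0, 0); first by exists p.
exists (- conf_map delta F c0 p, p, 0); last first.
  by rewrite tripleE !(add0r, addr0) subrr.
exists (- conf_map delta F c0 p).
by rewrite !mapsE linearN sp opprK.
Qed.

Lemma letters_commute l l' : l.1 != l'.1 ->
  two_letters mt jn frame_sp (letter_sp l) (letter_sp l') =
  two_letters mt jn frame_sp (letter_sp l') (letter_sp l).
Proof.
move=> ll.
have two f g : two_letters mt jn frame_sp (graph_sp f) (graph_sp g) = graph_sp (g \o f).
  by apply: two_graphs.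
rewrite /letter_sp !two; apply: eq_graph_sp; apply: fsym.
exact: letter_mapC ll.
Qed.

Lemma instr_hold q :
  all (fun p => p.1 <= p.2)%O (instr_ineqs mt jn frame_sp delta letter_sp state_sp q).
Proof.
rewrite /instr_ineqs; case dq : (delta q) => [r q'|r q1 q2|].
- apply/andP; split => //; rewrite [_.1]/fst [_.2]/snd act_state -[state_sp q]/(conf_sp _).
  rewrite (@eq_conf_sp _ (push_bottom (r, true) ([ffun=> [::]], q'))) ?lexx //.
  apply: reach_step; rewrite /= dq.
  by congr (Some (_, _)); apply/ffunP => i; rewrite !ffunE.
- apply/andP; split; [|apply/andP; split => //]; rewrite [_.1]/fst [_.2]/snd !act_state.
    rewrite (@eq_conf_sp _ ([ffun=> [::]], q1)) ?lexx //.
    apply: reach_step; rewrite /= dq !ffunE eqxx /=.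
    by congr (Some (_, _)); apply/ffunP => i; rewrite !ffunE; case: eqP.
  rewrite (@eq_conf_sp _ (push_bottom (r, false) ([ffun=> [::]], q2))) ?lexx //.
  apply: reach_step; rewrite /= dq !ffunE eqxx /=.
  by congr (Some (_, _)); apply/ffunP => i; rewrite !ffunE.
- apply/andP; split => //; rewrite [_.1]/fst [_.2]/snd /state_sp conf_sp_halt ?bot_sub //.
  by exists [ffun=> [::]], q; split => //; exact: reach_refl.
Qed.

Lemma ineqs_hold : all (fun p => p.1 <= p.2)%O
  (machine_ineqs mt jn frame_sp delta r0 r1 q0 letter_sp state_sp).
Proof.
rewrite !all_cat !all_flatten !all_map frame_holds.
apply/and5P; split => //.
- rewrite /alias_ineqs /g_base -[frame_sp 8]/(conf_sp base_conf) base_conf_sp.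
  by do 5!(apply/andP; split; first exact: lexx).
- by apply/allP => x _ /=; exact: bot_sub.
- by apply/allP => x _ /=; exact: sub_top.
apply/and4P; split; apply/allP => x _ /=.
- by rewrite graph_sub rel_image_bot_graph lexx.
- rewrite /comm_ineq; case: eqP => [_|/eqP xx]; first exact: lexx.
  by rewrite [X in (X, _)]letters_commute //; exact: lexx.
- by apply: triple_leP => p; exists (conf_map delta F ([ffun=> [::]], x) p).
- exact: instr_hold.
Qed.

Lemma shift_mapE k p : shift_map k p = p * 'X^k.
Proof.
transitivity (\sum_(i < size p) p`_i *: ('X^(i + k) : P)); first by [].
rewrite -[p in RHS]coefK poly_def mulr_suml; apply: eq_bigr => i _.
by rewrite -scalerAl exprD.
Qed.

Lemma iter_shift k : iter k (act (frame_sp 7)) (frame_sp 1) = line_sp (shift_map k).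
Proof.
elim: k => [|k IH] /=.
  by apply: eq_triple => // p; rewrite shift_mapE expr0 mulr1.
rewrite IH [frame_sp 7]/= act_graph //; apply: eq_triple => // p /=.
by rewrite !shift_mapE expr1 -mulrA -exprSr.
Qed.

(** The iterated images of [A] are the ideals generated by the powers of
    ['X], which decrease strictly. *)
Lemma iter_shift_inj : injective (fun k => iter k (act (frame_sp 7)) (frame_sp 1)).
Proof.
have lt i j : (i < j)%N -> line_sp (shift_map i) <> line_sp (shift_map j).
  move=> ij e; have : subspace_set (line_sp (shift_map i)) ('X^i, 0, 0).
    by exists 1; rewrite shift_mapE mul1r.
  rewrite e => -[p]; rewrite shift_mapE => /triple_inj[/(congr1 (fun q : P => q`_i))].
  by rewrite coefXn eqxx coefMXn ij => /eqP; rewrite oner_eq0.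
move=> i j /=; rewrite !iter_shift => e.
by case: (ltngtP i j) => // /lt; rewrite e.
Qed.
End Model.

(** * Embedding the model and the undecidability proof *)

Section InfiniteDimension.
Local Open Scope ring_scope.
Context (F : fieldType) (V : lmodType F).
Hypothesis V_infinite : infinite_dimensional V.

Lemma outside_span (s : seq V) :
  exists v, forall c : nat -> F, v <> \sum_(i < size s) c i *: s`_i.
Proof.
apply: contrapT => /forallNP no; apply: V_infinite.
exists (size s), (fun i => s`_i) => v.
have /existsNP[c /contrapT ->] := no v.
by exists (fun i : 'I_(size s) => c i).
Qed.

(** Each vector is chosen outside the span of the previous ones. *)
Lemma independent_sequence : exists e : nat -> V,
  forall n (c : nat -> F), e n <> \sum_(i < n) c i *: e i.
Proof.
have /choice[st stP] := outside_span.
pose pre := fix pre n := if n is k.+1 then rcons (pre k) (st (pre k)) else [::].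
have size_pre n : size (pre n) = n by elim: n => //= n IH; rewrite size_rcons IH.
have nth_pre n i : (i < n)%N -> (pre n)`_i = st (pre i).
  elim: n => // n IH; rewrite ltnS leq_eqVlt /= nth_rcons size_pre.
  by case/orP => [/eqP->|ltin]; rewrite ?ltnn ?eqxx // ltin IH.
exists (fun n => st (pre n)) => n c e; apply: (stP (pre n) c).
rewrite {1}e size_pre; apply: eq_bigr => i _.
by rewrite nth_pre.
Qed.

Lemma poly_embedding : exists f : {linear {poly F} -> V}, injective f.
Proof.
have [e eP] := independent_sequence.
pose f : {linear {poly F} -> V} := poly_lext e.
exists f; apply: raddf_inj => p fp0; apply/eqP; apply: contraT => pn0.
case sp : (size p) => [|k]; first by move/eqP: sp; rewrite size_poly_eq0 (negPf pn0).
have lead0 : p`_k != 0 by move: pn0; rewrite -lead_coef_eq0 /lead_coef sp.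
case: (eP k (fun i => - (p`_k)^-1 * p`_i)).
have : \sum_(i < k.+1) p`_i *: e i = 0 by rewrite -[RHS]fp0 /f /= /poly_lext sp.
rewrite big_ord_recr /= => /eqP; rewrite addr_eq0 => /eqP e0.
rewrite -[LHS]scale1r -(mulVf lead0) -scalerA -[p`_k *: e k]opprK -e0.
rewrite scalerN -scaleNr scaler_sumr; apply: eq_bigr => i _.
by rewrite scalerA.
Qed.
End InfiniteDimension.

Section Interleave.
Local Open Scope ring_scope.
Variable F : fieldType.
Local Notation P := {poly F}.
Local Notation W := (triple_poly F).

Definition stride_map j : {linear P -> P} := poly_lext (fun i => 'X^(i * 3 + j)).

Lemma coef_stride j k j' p : (j < 3)%N -> (j' < 3)%N ->
  (stride_map j p)`_(k * 3 + j') = if j == j' then p`_k else 0.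
Proof.
move=> j3 j'3; transitivity (\sum_(i < size p) p`_i * (k * 3 + j' == i * 3 + j)%N%:R).
  rewrite [stride_map j p]/= /poly_lext coef_sum; apply: eq_bigr => i _.
  by rewrite coefZ coefXn.
case: eqP => [<-|/eqP jj'].
  rewrite -[p in RHS]coefK poly_def coef_sum; apply: eq_bigr => i _.
  by rewrite coefZ coefXn eqn_add2r eqn_pmul2r.
rewrite big1 // => i _; case: eqP; rewrite ?mulr0 //; lia.
Qed.

(** The three components are recovered as the coefficients whose index is [0],
    [1] and [2] modulo [3]. *)
Definition interleave (x : W) : P :=
  stride_map 0 x.1.1 + stride_map 1 x.1.2 + stride_map 2 x.2.

Lemma interleave_is_linear : linear interleave.
Proof.
move=> a x y; rewrite /interleave !linearP !scalerDr.
by rewrite [X in X + _ = _]addrACA [LHS]addrACA.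
Qed.

HB.instance Definition _ :=
  GRing.isLinear.Build F W P *:%R interleave interleave_is_linear.

Lemma interleave_inj : injective interleave.
Proof.
apply: raddf_inj => -[[p q] r] /polyP e.
by congr (_, _, _); apply/polyP => k; rewrite coef0;
  [have := e (k * 3 + 0)%N|have := e (k * 3 + 1)%N|have := e (k * 3 + 2)%N];
  rewrite coef0 !coefD !coef_stride //= !(addr0, add0r).
Qed.
End Interleave.

Section Presentation.
Local Open Scope ring_scope.
Variables (Q R : finType) (delta : Q -> instr Q R) (r0 r1 : R) (q0 : Q).

Definition others := (R * bool + Q)%type.
(** The fixed generators receive the first numbers, whatever the machine. *)
Definition ngens := (13 + #|{: others}|)%N.

Definition fixed_gen (i : nat) : 'I_ngens := lshift #|{: others}| (inord i : 'I_13).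
Definition other_gen (x : others) : 'I_ngens := rshift 13 (enum_rank x).

Definition le_rel (p : lterm ngens * lterm ngens) := (LMeet p.1 p.2, p.1).

Definition machine_rels : seq (lterm ngens * lterm ngens) :=
  map le_rel (machine_ineqs (@LMeet _) (@LJoin _) (LGen \o fixed_gen) delta r0 r1 q0
    (LGen \o other_gen \o inl) (LGen \o other_gen \o inr)).

Definition start_rel n m :=
  le_rel (start_ineq (@LMeet ngens) (@LJoin _) (LGen \o fixed_gen) n m).

Section Satisfaction.
Local Open Scope ring_scope.
Variables (d : Order.disp_t) (L : latticeType d) (g : 'I_ngens -> L).
Local Notation mt := (@Order.meet d L).
Local Notation jn := (@Order.join d L).

Lemma satisfies_le_rel s :
  satisfies g (map le_rel s) <->
  all (fun p => p.1 <= p.2)%O (map (fun p => (lterm_eval g p.1, lterm_eval g p.2)) s).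
Proof.
elim: s => //= p s [IH1 IH2]; rewrite leEmeet; split.
  by move=> [-> /IH1 ->]; rewrite eqxx.
by move=> /andP[/eqP e /IH2].
Qed.

Lemma satisfies_machine n m : satisfies g (start_rel n m :: machine_rels) <->
  ((start_ineq mt jn (g \o fixed_gen) n m).1 <= (start_ineq mt jn (g \o fixed_gen) n m).2)%O
  /\ all (fun p => p.1 <= p.2)%O (machine_ineqs mt jn (g \o fixed_gen) delta r0 r1 q0
      (g \o other_gen \o inl) (g \o other_gen \o inr)).
Proof.
have satE := satisfies_le_rel (machine_ineqs (@LMeet _) (@LJoin _) (LGen \o fixed_gen)
  delta r0 r1 q0 (LGen \o other_gen \o inl) (LGen \o other_gen \o inr)).
rewrite (@ineqs_nat _ _ _ _ mt jn (lterm_eval g)) // -/machine_rels in satE.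
have startE := @start_nat _ _ (@LMeet ngens) (@LJoin ngens) mt jn (lterm_eval g)
  (fun _ _ => erefl) (fun _ _ => erefl) (LGen \o fixed_gen) n m.
rewrite -[start_ineq mt jn _ n m]startE leEmeet.
split=> [[e /satE h]|[/eqP e /satE h]]; split=> //; exact/eqP.
Qed.
End Satisfaction.

Lemma halts_bounded (A : lattice_class) n m :
  (forall (d : Order.disp_t) (L : latticeType d), A d L -> modular L) ->
  r0 != r1 ->
  halts delta (unary (fun r => if r == r0 then n else if r == r1 then m else 0%N), q0) ->
  finitely_bounded A (Presentation (start_rel n m :: machine_rels)).
Proof.
move=> A_modular r01 h; exists 1%N => d L AL [g [gen /satisfies_machine[start rels]]].
have collapse := halting_collapse (A_modular _ _ AL) r01 rels start h.
have gbot (i : 'I_ngens) : g i = g (fixed_gen 0).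
  apply: collapse; rewrite !mem_cat.
  rewrite -(@fintype.splitK 13 #|{: others}| i); case: (fintype.split i) => [j|k].
    apply/orP; left; apply/mapP; exists (val j); first by rewrite mem_iota /=.
    by rewrite /= /fixed_gen inord_val.
  rewrite -(enum_valK k); case: (enum_val k) => [l|q]; apply/orP; right; apply/orP.
    by left; apply/mapP; exists l; rewrite ?mem_enum.
  by right; apply/mapP; exists q; rewrite ?mem_enum.
have allbot x : x = g (fixed_gen 0).
  apply: (gen (fun x => x = g (fixed_gen 0))) => // y z -> ->.
  by rewrite meetxx joinxx.
have -> : ([set: L] = [set g (fixed_gen 0)])%classic.
  by apply/seteqP; split => // x _; exact: allbot.
by have := @card_set1 _ (g (fixed_gen 0)); rewrite card_eq_le => /andP[].
Qed.

Lemma runs_unbounded (A : lattice_class) n m (F : fieldType) (V : lmodType F) :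
  closed_under_fg_sublattices A -> infinite_dimensional V ->
  A _ (subspace V : latticeType _) -> r0 != r1 ->
  ~ halts delta (unary (fun r => if r == r0 then n else if r == r1 then m else 0%N), q0) ->
  ~ finitely_bounded A (Presentation (start_rel n m :: machine_rels)).
Proof.
move=> A_closed V_inf A_LV r01 runs.
have [f f_inj] := poly_embedding V_inf.
pose phi : {linear triple_poly F -> V} := f \o @interleave F.
have phi_inj : injective phi by apply: inj_comp f_inj _; exact: interleave_inj.
pose fx := frame_sp F delta r0 r1 q0 n m.
pose g (i : 'I_ngens) := match fintype.split i with
  | inl j => fx j
  | inr k => match enum_val k with
      | inl l => letter_sp F delta l
      | inr q => state_sp F delta q
      end
  end.
have g_fixed : g \o fixed_gen = fx.
  apply: funext => i; rewrite /= /g /fixed_gen (@fintype.unsplitK 13 _ (inl _)).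
  rewrite val_insubd; case: (ltnP i 13) => // i13.
  by rewrite /fx /frame_sp [RHS]nth_default.
have g_other x : g (other_gen x) =
    match x with inl l => letter_sp F delta l | inr q => state_sp F delta q end.
  by rewrite /g /other_gen (@fintype.unsplitK 13 _ (inr _)) enum_rankK.
have g_letter : g \o other_gen \o inl = letter_sp F delta.
  by apply: funext => l /=; rewrite g_other.
have g_state : g \o other_gen \o inr = state_sp F delta.
  by apply: funext => q /=; rewrite g_other.
pose mt := @Order.meet _ (subspace (triple_poly F)).
pose jn := @Order.join _ (subspace (triple_poly F)).
apply: (infinite_not_bounded A_closed A_LV phi_inj (g := g)
  (x := fun k => iter k (letter_act mt jn fx (fx 7)) (fx 1))).
- apply/satisfies_machine; rewrite g_fixed g_letter g_state.
  by split; [exact: start_holds|exact: ineqs_hold].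
- exact: iter_shift_inj.
- move=> k; pose tfx := LGen \o fixed_gen.
  suff -> : iter k (letter_act mt jn fx (fx 7)) (fx 1) =
      lterm_eval g (iter k (letter_act (@LMeet _) (@LJoin _) tfx (tfx 7)) (tfx 1)).
    exact: in_sublattice_eval.
  elim: k => [|k IH]; first by rewrite -g_fixed.
  rewrite !iterS IH (@act_nat _ _ _ _ mt jn (lterm_eval g)) //.
  by rewrite -g_fixed.
Qed.
End Presentation.

Section StartCode.
Definition meet_code a b := cpair 1 (cpair a b).
Definition join_code a b := cpair 2 (cpair a b).
Definition gen_code i := cpair 0 (inord i : 'I_13).

Definition start_code n m :=
  let p := start_ineq meet_code join_code gen_code n m in
  cpair (meet_code p.1 p.2) p.1.

(** The code of a presentation with [n] generators and the start relation for
    [n] and [m], followed by the relations with code [m]. *)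
Definition instance_code n m := cpair n (cpair (start_code n m) m).+1.

Lemma pres_code_cons n (r : lterm n * lterm n) rels :
  pres_code (Presentation (r :: rels)) =
  cpair n (cpair (cpair (lterm_code r.1) (lterm_code r.2)) (rels_code rels)).+1.
Proof. by []. Qed.

(** The code of a term is a homomorphism into the natural numbers with the two
    operations [meet_code] and [join_code]: this is naturality of
    [start_ineq]. *)
Lemma start_rel_code (Q R : finType) n m :
  cpair (lterm_code (start_rel Q R n m).1) (lterm_code (start_rel Q R n m).2) =
  start_code n m.
Proof.
have startE := @start_nat _ _ (@LMeet _) (@LJoin _) meet_code join_code
  (@lterm_code (ngens Q R)) (fun _ _ => erefl) (fun _ _ => erefl)
  (LGen \o fixed_gen Q R) n m.
have -> : start_code n m =
    let p := start_ineq meet_code join_code (@lterm_code _ \o (LGen \o fixed_gen Q R)) n m in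
    cpair (meet_code p.1 p.2) p.1 by [].
by rewrite -startE /start_rel; case: (start_ineq _ _ _ n m).
Qed.

Lemma computable_instance_code : computable2 instance_code.
Proof.
have cpairP k (G G' : k.-tuple nat -> nat) : computable G -> computable G' ->
    computable (fun xs => cpair (G xs) (G' xs)).
  exact: computable_comp2 computable_cpair.
have constP k c : computable (fun _ : k.-tuple nat => c) by exact: computable_const.
have meetP k (G G' : k.-tuple nat -> nat) : computable G -> computable G' ->
    computable (fun xs => meet_code (G xs) (G' xs)).
  by move=> cG cG'; apply: (cpairP); [exact: constP|apply: (cpairP)].
have joinP k (G G' : k.-tuple nat -> nat) : computable G -> computable G' ->
    computable (fun xs => join_code (G xs) (G' xs)).
  by move=> cG cG'; apply: (cpairP); [exact: constP|apply: (cpairP)].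
have actP k l (G : k.-tuple nat -> nat) : computable G ->
    computable (fun xs => letter_act meet_code join_code gen_code l (G xs)).
  move=> cG; do 3!(apply: (meetP); [apply: (joinP)|exact: constP]) => //; exact: constP.
have iterP k l (G K : k.-tuple nat -> nat) : computable G -> computable K ->
    computable (fun xs => iter (K xs) (letter_act meet_code join_code gen_code l) (G xs)).
  move=> cG cK; apply: computable_iter => //; apply: (actP); exact: computable_proj.
have nP := @computable_proj 2 ord0; have mP := @computable_proj 2 ord_max.
have c0P : computable (fun t : 2.-tuple nat =>
    (start_ineq meet_code join_code gen_code (tnth t ord0) (tnth t ord_max)).2).
  apply: (joinP); last exact: constP.
  by apply: (actP); apply: (iterP) => //; apply: (actP); apply: (iterP).
apply: (cpairP) => //; apply: computable_succ; apply: (cpairP) => //.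
by apply: (cpairP); [apply: (meetP) => //|]; exact: constP.
Qed.
End StartCode.

Theorem theorem1 (A : lattice_class)
  (A_modular : forall (d : Order.disp_t) (L : latticeType d), A d L -> modular L)
  (A_closed : closed_under_fg_sublattices A)
  (F : fieldType) (V : lmodType F)
  (V_infinite : infinite_dimensional V)
  (A_LV : A _ (subspace V : latticeType _)) :
  ~ algorithmically_solvable (finitely_bounded A).
Proof.
move=> [f decides].
have [p pP] := computable_instance_code.
have [Q [R [delta [r0 [r1 [q0 [r01 machine]]]]]]] :=
  recfun_machine (RComp f (fun _ : 'I_1 => p)).
(* The inputs of the machine describe its own relations. *)
pose N := ngens Q R; pose rels := machine_rels delta r0 r1 q0.
pose M := rels_code rels.
pose pres := Presentation (start_rel Q R N M :: rels).
have presE : pres_code pres = instance_code N M.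
  by rewrite /pres pres_code_cons start_rel_code.
have [halting running] := machine N M.
have decided v : rec_graph f [tuple pres_code pres] v ->
    rec_graph (RComp f (fun _ : 'I_1 => p)) [tuple N; M] v.
  move=> fv; exists [tuple pres_code pres]; split => //.
  by move=> i; rewrite ord1 presE; exact: pP.
have [yes no] := decides pres.
have [bounded|unbounded] := pselect (finitely_bounded A pres).
  apply: (runs_unbounded A_closed V_infinite A_LV r01 _ bounded).
  exact: (running (decided _ (yes bounded))).
apply: (unbounded); apply: (halts_bounded A_modular r01).
exact: (halting (decided _ (no unbounded))).
Qed.
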